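(* Let $c(3,2)$ denote the length of a shortest $3$-collapsing word on a two letter alphabet. Then $34\le c(3,2)\le 53$.
   Context: A (semi)automaton is a triple $\mathcal A=(Q,\Sigma,\delta)$ with $Q$ a finite set of states, $\Sigma$ an alphabet and $\delta:Q\times\Sigma\to Q$ a total function. Words act on states from the right, letter by letter from left to right: $qw$ is the state reached from $q$ by reading $w$, and $Qw=\{qw: q\in Q\}$. The deficiency of $w\in\Sigma^+$ for $\mathcal A$ is $|Q|-|Qw|$. The word $w$ is $3$-compressing for $\mathcal A$ if its deficiency is at least $3$; $\mathcal A$ is $3$-compressible if some word is $3$-compressing for it. A word $w\in\Sigma^+$ is $3$-collapsing if it is $3$-compressing for every $3$-compressible automaton with input alphabet $\Sigma$. *)

(* Defs.v *)
From HB Require Import structures.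
From mathcomp Require Import all_boot.

Set Implicit Arguments.
Unset Strict Implicit.
Unset Printing Implicit Defensive.

Record semiautomaton (Sigma : finType) := Semiautomaton {
  state : finType;
  delta : state -> Sigma -> state
}.

(* Words act from the right, reading letters from left to right. *)
Definition act (Sigma : finType) (A : semiautomaton Sigma)
    (q : state A) (w : seq Sigma) : state A :=
  foldl (@delta Sigma A) q w.

Definition image_set (Sigma : finType) (A : semiautomaton Sigma)
    (w : seq Sigma) : {set state A} :=
  [set act q w | q : state A].

(* The truncated subtraction is harmless: #|Qw| <= #|Q|. *)
Definition deficiency (Sigma : finType) (A : semiautomaton Sigma)
    (w : seq Sigma) : nat :=
  #|state A| - #|image_set A w|.

Definition compressing (k : nat) (Sigma : finType) (A : semiautomaton Sigma)
    (w : seq Sigma) : bool :=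
  (w != [::]) && (k <= deficiency A w).

Definition compressible (k : nat) (Sigma : finType)
    (A : semiautomaton Sigma) : Prop :=
  exists w : seq Sigma, compressing k A w.

Definition collapsing (k : nat) (Sigma : finType) (w : seq Sigma) : Prop :=
  w != [::] /\
  forall A : semiautomaton Sigma, compressible k A -> compressing k A w.

(* "c(k, t) exists and equals c".  The value depends on the alphabet only
   through its number t of letters, so c is required to be the minimum for
   every t-letter alphabet. *)
Definition is_shortest_collapsing_length (k t c : nat) : Prop :=
  forall Sigma : finType, #|Sigma| = t ->
    (exists2 w : seq Sigma, collapsing k w & size w = c) /\
    (forall w : seq Sigma, collapsing k w -> c <= size w).

Lemma is_shortest_collapsing_length_unique (k t c c' : nat) :
  is_shortest_collapsing_length k t c ->
  is_shortest_collapsing_length k t c' -> c = c'.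
Proof.
move=> /(_ 'I_t (card_ord t))[[w kw <-] minw].
move=> /(_ 'I_t (card_ord t))[[w' kw' <-] minw'].
by apply/eqP; rewrite eqn_leq minw // minw'.
Qed.

(* Main.v *)
Require Import Defs.
From HB Require Import structures.
From mathcomp Require Import all_boot.
From Stdlib Require List.
From Stdlib Require Import Classical.

Set Implicit Arguments.
Unset Strict Implicit.
Unset Printing Implicit Defensive.

(** The deficiency of a word [w] is the number of states that it misses, and the
    missed sets of all words form a deterministic automaton: the set missed by
    [w c] consists of the states all of whose preimages under [c] are missed by
    [w] ([missed_rcons]). As long as [w] is not 3-compressing, these sets have at
    most two elements.

    Upper bound. A word of length 53 is shown to be 3-collapsing, although it has
    to be tested on automata of unbounded size. Following missed sets of at most
    two states touches few states, so an unknown automaton is explored lazily: a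
    sketch records what is known of it, and a step that needs an unknown kernel
    class, hole or image branches over all possibilities ([step_ok]). A branch
    ends when a factor of the word loses three states, or when the missed sets
    that are reachable from the empty one are all known and have at most two
    elements, so that the automaton is not 3-compressible at all ([explore_ok]).
    For a suitable word this tree is finite and small, and
    [collapses_by_exploration] turns its computation into a proof.

    Lower bound. A finite list of small 3-compressible automata is given such
    that no word of length 33 compresses all of them by 3. The words are searched
    exhaustively, letter by letter ([search_ok]). Automata are grouped in teams,
    and the product of the automata of missed sets of a team tells whether a
    given number of letters can still compress the whole team ([level_valid]); a
    prefix is abandoned when this fails for some team. By symmetry the first
    letter is fixed, and shorter words are padded ([lower_bound]). *)

(** * Missed sets *)

Section Missed.

Variables (T : finType) (f : bool -> T -> T).

Definition run (q : T) (w : seq bool) : T := foldl (fun q c => f c q) q w.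

(** The deficiency of [w] is the number of states that it misses. *)
Definition missed (w : seq bool) : {set T} := ~: [set run q w | q : T].

(** Reading [c] when the states of [M] are no longer reached loses exactly the
    states all of whose preimages lie in [M]; so the missed sets of all words
    form a deterministic automaton, which everything below runs on. *)
Definition lost (c : bool) (M : {set T}) : {set T} :=
  [set q | [forall p, (f c p == q) ==> (p \in M)]].

Lemma missed_nil : missed [::] = set0.
Proof.
apply/setP => q; rewrite !inE; apply/negbTE; rewrite negbK.
by apply/imsetP; exists q.
Qed.

Lemma missed_rcons w c : missed (rcons w c) = lost c (missed w).
Proof.
apply/setP => q; rewrite !inE; apply/negP/forallP.
- move=> Hq p; apply/implyP => /eqP Hp; rewrite inE; apply/negP.
  case/imsetP => r _ Er; apply: Hq; apply/imsetP; exists r => //.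
  by rewrite /run foldl_rcons -/(run r w) -Er Hp.
- move=> H /imsetP[r _ Er]; move: (H (run r w)).
  rewrite Er /run foldl_rcons eqxx /= inE => /negP; apply.
  by apply/imsetP; exists r.
Qed.

Lemma lostS c (M N : {set T}) : M \subset N -> lost c M \subset lost c N.
Proof.
move=> /subsetP MN; apply/subsetP => q; rewrite !inE => /forallP H.
apply/forallP => p; apply/implyP => E; apply: MN; exact: (implyP (H p)).
Qed.

Lemma missed_catr u w : missed w \subset missed (u ++ w).
Proof.
elim/last_ind: w => [|w c IH]; first by rewrite missed_nil sub0set.
by rewrite -rcons_cat !missed_rcons lostS.
Qed.

Lemma leq_card_missed u w : #|missed u| <= #|missed (u ++ w)|.
Proof.
have card_im v : #|[set run q v | q : T]| + #|missed v| = #|T|.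
  by rewrite cardsC.
have E : [set run q (u ++ w) | q : T] =
         [set run q w | q in [set run q u | q : T]].
  rewrite -imset_comp; apply: eq_imset => q /=.
  by rewrite /run foldl_cat.
have := leq_imset_card (run ^~ w) [set run q u | q : T].
rewrite -E => le_im; have := card_im u; rewrite -(card_im (u ++ w)).
by move=> Eu; rewrite -(leq_add2l #|[set run q u | q : T]|) Eu leq_add2r.
Qed.

(** Deficiency does not decrease when a word is extended on either side, hence a
    word is 3-compressing as soon as one of its factors is. *)
Lemma leq_missed_factor v u w : #|missed u| <= #|missed (v ++ u ++ w)|.
Proof.
rewrite catA; apply: leq_trans (leq_card_missed _ _).
exact: subset_leq_card (missed_catr _ _).
Qed.

End Missed.

(** * Words over the alphabet of booleans *)

(** Being 3-collapsing for the alphabet [bool], with state sets separated from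
    the record of semiautomata. *)
Definition collapses (w : seq bool) : Prop :=
  w != [::] /\ forall (T : finType) (f : bool -> T -> T) (u : seq bool),
    2 < #|missed f u| -> 2 < #|missed f w|.

Section Transport.

Variables (Sigma : finType) (enc : Sigma -> bool) (dec : bool -> Sigma).
Hypotheses (encK : cancel enc dec) (decK : cancel dec enc).

Lemma act_run (A : semiautomaton Sigma) q (w : seq Sigma) :
  act (A := A) q w =
  run (fun c q => @delta Sigma A q (dec c)) q (map enc w).
Proof.
rewrite /act /run; elim: w q => //= s w IH q.
by rewrite encK IH.
Qed.

Lemma deficiency_missed (A : semiautomaton Sigma) (w : seq Sigma) :
  deficiency A w =
  #|missed (fun c q => @delta Sigma A q (dec c)) (map enc w)|.
Proof.
rewrite /deficiency /missed [RHS]cardsCs setCK; congr (_ - #|pred_of_set _|).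
by apply: eq_imset => q; rewrite act_run.
Qed.

Lemma collapsing_collapses (w : seq Sigma) :
  collapsing 3 w <-> collapses (map enc w).
Proof.
split=> -[w0 H]; split; try by case: (w) w0.
- move=> T f u Hu.
  pose A := @Semiautomaton Sigma T (fun q s => f (enc s) q).
  have defA v : deficiency A v = #|missed f (map enc v)|.
    rewrite (deficiency_missed A); congr #|pred_of_set (~: _)|.
    apply: eq_imset => q; rewrite /run.
    by elim: (map enc v) q => //= c v' IH q; rewrite decK IH.
  have /H : compressible 3 A.
    exists (map dec u); rewrite /compressing defA (mapK decK) Hu andbT.
    by case: u Hu => //; rewrite missed_nil cards0.
  by rewrite /compressing defA => /andP[].
- move=> A [u]; rewrite /compressing !deficiency_missed.
  have ->: w != [::] by case: (w) w0.
  by case/andP => _; apply: H.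
Qed.

End Transport.

Lemma two_letters (Sigma : finType) : #|Sigma| = 2 ->
  exists (enc : Sigma -> bool) (dec : bool -> Sigma), cancel enc dec /\ cancel dec enc.
Proof.
move=> card2; have /card_gt0P[s _] : 0 < #|Sigma| by rewrite card2.
have /cards1P[t Et] : #|[set~ s]| == 1 by rewrite cardsC1 card2.
have st : t != s by rewrite -in_setC1 Et set11.
have neq_s z : z != s -> z = t.
  by move=> zs; apply/set1P; rewrite -Et !inE.
exists (fun z => z != s), (fun b : bool => if b then t else s); split.
- by move=> z; case: eqP => [//|/eqP /neq_s].
- by case; rewrite ?eqxx ?st.
Qed.

Lemma collapses_negb w : collapses w -> collapses (map negb w).
Proof.
have idK : cancel id (id : bool -> bool) by [].
move=> Hw; apply/(collapsing_collapses negbK negbK).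
by apply/(collapsing_collapses idK idK); rewrite map_id.
Qed.

(** * Sketches of automata *)

(** A letter acts injectively on its kernel classes; a key designates a class:
    either a named state that is alone in its class, or one of the at most two
    nontrivial classes. *)
Inductive key := Single of nat | Class of bool.

(** Partial knowledge of the action of one letter. The states met so far are
    named by natural numbers; [sizes] gives the sizes of the nontrivial kernel
    classes, 0 for an absent one, [holes] the states outside the image, once they
    are named, [labels] the nontrivial class of a named state, with [None] for a
    state alone in its class, and [moves] the name of the image of a class. *)
Record letter := Letter {
  sizes : bool -> nat;
  holes : option (seq nat);
  labels : seq (nat * option bool);
  moves : seq (key * nat)
}.

(** The names in use are those below [bound]; distinct names are distinct states. *)
Record sketch := Sketch { bound : nat; letters : bool -> letter }.

Definition mem_name (i : nat) (s : seq nat) : bool := has (eqn i) s.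

Definition eq_key (k l : key) : bool :=
  match k, l with
  | Single i, Single j => eqn i j
  | Class b, Class c => eqb b c
  | _, _ => false
  end.

Definition defect (l : letter) : nat := (sizes l false).-1 + (sizes l true).-1.

Fixpoint label_of (i : nat) (s : seq (nat * option bool)) : option (option bool) :=
  match s with
  | [::] => None
  | (j, b) :: s' => if eqn i j then Some b else label_of i s'
  end.

Fixpoint move_of (k : key) (s : seq (key * nat)) : option nat :=
  match s with
  | [::] => None
  | (l, t) :: s' => if eq_key k l then Some t else move_of k s'
  end.

Definition in_class (b : bool) (o : option bool) : bool :=
  match o with Some c => eqb b c | None => false end.

Definition add_label (l : letter) i b :=
  Letter (sizes l) (holes l) ((i, b) :: labels l) (moves l).
Definition set_holes (l : letter) h :=
  Letter (sizes l) (Some h) (labels l) (moves l).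
Definition add_move (l : letter) k t :=
  Letter (sizes l) (holes l) (labels l) ((k, t) :: moves l).
Definition set_letter (n : nat) (P : sketch) (c : bool) (l : letter) :=
  let: other := letters P (~~ c) in
  Sketch n (fun d => if eqb c d then l else other).

Definition room (l : letter) (b : bool) : bool :=
  count (fun p => in_class b p.2) (labels l) < sizes l b.

(** All ways to decide the kernel classes of the names in [M]. *)
Fixpoint label_all (l : letter) (M : seq nat) : seq letter :=
  match M with
  | [::] => [:: l]
  | i :: M' =>
    List.flat_map (fun l' => label_all l' M')
      (if label_of i (labels l) is Some _ then [:: l] else
       add_label l i None ::
       [seq add_label l i (Some b) | b <- [:: false; true] & room l b])
  end.

Definition lab (l : letter) (i : nat) : option bool := odflt None (label_of i (labels l)).

(** The kernel classes contained in [M]: their images are lost after [M]. *)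
Definition keys_of (l : letter) (M : seq nat) : seq key :=
  [seq Single i | i <- M & ~~ isSome (lab l i)] ++
  [seq Class b | b <- [:: false; true] &
     (0 < sizes l b) && eqn (count (fun i => in_class b (lab l i)) M) (sizes l b)].

(** All ways to name [k] distinct states when [n] names are in use, with the new
    number of names. *)
Fixpoint fresh_names (k n : nat) : seq (seq nat * nat) :=
  match k with
  | 0 => [:: ([::], n)]
  | k'.+1 =>
    List.flat_map (fun hn : seq nat * nat => let: (h, m) := hn in
       [seq (rcons h i, m) | i <- iota 0 m & ~~ mem_name i h] ++ [:: (rcons h m, m.+1)])
     (fresh_names k' n)
  end.

Definition name_holes (n : nat) (l : letter) : seq (seq nat * (nat * letter)) :=
  match holes l with
  | Some h => [:: (h, (n, l))]
  | None => [seq (hn.1, (hn.2, set_holes l hn.1)) | hn <- fresh_names (defect l) n]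
  end.

Fixpoint name_targets (h : seq nat) (n : nat) (l : letter) (ks : seq key) :
    seq (seq nat * (nat * letter)) :=
  match ks with
  | [::] => [:: ([::], (n, l))]
  | k :: ks' =>
    List.flat_map (fun x : nat * (nat * letter) => let: (t, (n', l')) := x in
        [seq (t :: y.1, y.2) | y <- name_targets h n' l' ks'])
      (match move_of k (moves l) with
       | Some t => [:: (t, (n, l))]
       | None =>
         (n, (n.+1, add_move l k n)) ::
         [seq (t, (n, add_move l k t)) |
            t <- iota 0 n & ~~ mem_name t h && ~~ has (fun m => eqn t m.2) (moves l)]
       end)
  end.

(** All completions of [P] that determine the set lost by [c] after [M], each
    with the names of that set; the set is not named, and [None] is returned,
    if it has more than two elements. *)
Definition step (P : sketch) (M : seq nat) (c : bool) : seq (sketch * option (seq nat)) :=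
  List.flat_map (fun l =>
    let ks := keys_of l M in
    if 2 < defect l + size ks then [:: (set_letter (bound P) P c l, None)] else
    List.flat_map (fun x : seq nat * (nat * letter) => let: (h, (n, l')) := x in
      [seq (set_letter y.2.1 P c y.2.2, Some (h ++ y.1)) | y <- name_targets h n l' ks])
      (name_holes (bound P) l))
  (label_all (letters P c) M).

Fixpoint survivors (s : seq (sketch * option (seq nat))) : seq (sketch * seq nat) :=
  match s with
  | [::] => [::]
  | (P, Some M) :: s' => (P, M) :: survivors s'
  | (_, None) :: s' => survivors s'
  end.

Definition same_names (M N : seq nat) : bool :=
  all (fun i => mem_name i N) M && all (fun i => mem_name i M) N.

(** Whether the missed sets reachable from those in [seen] are small in every
    automaton that [P] describes; [todo] lists the transitions left to follow. *)
Fixpoint settled (fuel : nat) (P : sketch) (seen : seq (seq nat)) (todo : seq (seq nat * bool)) :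
    bool :=
  match fuel with
  | 0 => false
  | fuel'.+1 =>
    match todo with
    | [::] => true
    | (M, c) :: todo' =>
      all (fun x : sketch * option (seq nat) =>
        match x with
        | (_, None) => false
        | (P', Some M') =>
          (size M' <= 2) &&
          if has (same_names M') seen then settled fuel' P' seen todo'
          else settled fuel' P' (M' :: seen) (todo' ++ [:: (M', false); (M', true)])
        end) (step P M c)
    end
  end.

Section Explore.
Variable w0 : seq bool.

(** A set of positions of [w0] is given by a mask; position [i] is the end of the
    prefix of length [i]. The result of [advance] is to be shifted by one. *)
Fixpoint advance (c : bool) (w : seq bool) (ps : bitseq) : bitseq :=
  match w, ps with
  | d :: w', p :: ps' => (p && eqb c d) :: advance c w' ps'
  | _, _ => [::]
  end.

Fixpoint mask_diff (p q : bitseq) : bitseq :=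
  match p, q with
  | b :: p', c :: q' => (b && ~~ c) :: mask_diff p' q'
  | _, _ => p
  end.

Fixpoint mask_or (p q : bitseq) : bitseq :=
  match p, q with
  | b :: p', c :: q' => (b || c) :: mask_or p' q'
  | [::], _ => q
  | _, _ => p
  end.

Fixpoint seen_mask (M : seq nat) (known : seq (seq nat * bitseq)) : bitseq :=
  match known with
  | [::] => [::]
  | (N, p) :: known' => if same_names M N then p else seen_mask M known'
  end.

(** A missed set [M], a letter to read after [M], and the positions of [w0]
    reached when it is read: factors of [w0] that end there and that miss the
    resulting set are known. *)
Definition item := (seq nat * bool * bitseq)%type.

Definition spawn (M : seq nat) (ps : bitseq) : seq item :=
  List.flat_map (fun c => let ps' := false :: advance c w0 ps in
    if has id ps' then [:: (M, c, ps')] else [::]) [:: false; true].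

Fixpoint cheapest (best : nat * item) (rest : seq (nat * item)) : item :=
  match rest with
  | [::] => best.2
  | x :: rest' => cheapest (if x.1 < best.1 then x else best) rest'
  end.

(** The case analysis. An item is followed at once if all but at most one of the
    completions of its step lose three states, since [w0] then compresses the
    automata described by the former; otherwise it is suspended with the number
    of completions left. When all items are suspended, the one with the fewest
    completions is split; a dynamic choice keeps the tree small. Only when every
    factor of [w0] has been followed does one need to see that no word at all
    compresses. The list [known] only avoids following the same set twice from
    the same position. *)
Fixpoint explore (fuel : nat) (P : sketch) (known : seq (seq nat * bitseq))
    (todo : seq item) (pend : seq (nat * item)) : bool :=
  match fuel with
  | 0 => false
  | fuel'.+1 =>
    match todo with
    | (M, c, ps) as it :: todo' =>
      match survivors (step P M c) with
      | [::] => true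
      | [:: (P', M')] =>
        let old := seen_mask M' known in
        let new := mask_diff ps old in
        if has id new then
          explore fuel' P' ((M', mask_or ps old) :: known) (spawn M' new ++ todo') pend
        else explore fuel' P' known todo' pend
      | s => explore fuel' P known todo' ((size s, it) :: pend)
      end
    | [::] =>
      match pend with
      | [::] => settled fuel' P [:: [::]] [:: ([::], false); ([::], true)]
      | x :: pend' =>
        let: (M, c, _) := cheapest x pend' in
        all (fun y : sketch * seq nat => explore fuel' y.1 known [seq z.2 | z <- pend] [::])
          (survivors (step P M c))
      end
    end
  end.

Definition blank (sz : bool -> nat) := Letter sz None [::] [::].

Definition start (sa sb : bool -> nat) : sketch :=
  Sketch 0 (fun c => blank (if c then sb else sa)).

Definition initial_mask := nseq (size w0).+1 true.

Definition collapses_shape (fuel : nat) (sa sb : bool -> nat) : bool :=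
  explore fuel (start sa sb) [:: ([::], initial_mask)] (spawn [::] initial_mask) [::].

End Explore.

Definition class_sizes (m n : nat) (b : bool) : nat := if b then n else m.

(** A letter of deficiency at most 2 is a permutation, or has one nontrivial
    kernel class, of size 2 or 3, or two of size 2. *)
Definition shapes : seq (bool -> nat) :=
  [:: class_sizes 0 0; class_sizes 2 0; class_sizes 3 0; class_sizes 2 2].

(** * Sketches and automata *)

Lemma eqn_eq (i j : nat) : eqn i j = (i == j). Proof. by []. Qed.

Lemma mem_nameE i s : mem_name i s = (i \in s).
Proof. by rewrite /mem_name; elim: s => //= j s ->; rewrite inE. Qed.

Lemma eq_keyP : Equality.axiom eq_key.
Proof.
move=> [i|b] [j|c] /=; try by constructor.
  by rewrite eqn_eq; apply: (iffP eqP) => [->|[]].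
by apply: (iffP eqP) => [->|[]].
Qed.
HB.instance Definition _ := hasDecEq.Build key eq_keyP.

Lemma eq_keyE k l : eq_key k l = (k == l). Proof. by []. Qed.

(** [cl] tells the nontrivial kernel classes of [g], of sizes [sz], and [hs]
    enumerates the states outside its image. *)
Record kernel (T : finType) (g : T -> T) (sz : bool -> nat)
    (cl : T -> option bool) (hs : seq T) : Prop := Kernel {
  kernel_eq : forall x y, g x = g y <-> x = y \/ (cl x <> None /\ cl x = cl y);
  kernel_size : forall b, #|[set x | cl x == Some b]| = sz b;
  kernel_uniq : uniq hs;
  kernel_hole : forall q, (q \in hs) = (q \notin codom g);
  kernel_defect : size hs = (sz false).-1 + (sz true).-1
}.

Section Names.
Variable T : eqType.
Implicit Types (xs ys : seq T) (M : seq nat).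

(** Name [i] stands for the [i]-th state of [xs]. *)
Definition named xs M ms := map (onth xs) M = map Some ms.

Lemma onth_ext xs ys i (x : T) : onth xs i = Some x -> onth (xs ++ ys) i = Some x.
Proof.
move=> H; rewrite onth_cat; case: ltnP => // /onth_default.
by rewrite H.
Qed.

Lemma onth_size xs i x : onth xs i = Some x -> i < size xs.
Proof. by move=> H; rewrite -onthTE H. Qed.

Lemma onth_last xs (x : T) : onth (xs ++ [:: x]) (size xs) = Some x.
Proof. by rewrite onth_cat ltnn subnn. Qed.

Lemma onth_uniq xs i j x : uniq xs -> onth xs i = Some x -> onth xs j = Some x -> i = j.
Proof.
move=> u Hi Hj; apply: (onth_inj _ _ _ u); last by rewrite Hi Hj.
by rewrite gtn_min (onth_size Hj).
Qed.

Lemma named_cons xs i M ms : named xs (i :: M) ms ->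
  exists x ms', [/\ ms = x :: ms', onth xs i = Some x & named xs M ms'].
Proof. by case: ms => //= x ms' [Hx H]; exists x, ms'. Qed.

Lemma named_size xs M ms : named xs M ms -> size M = size ms.
Proof. by move/(congr1 size); rewrite !size_map. Qed.

Lemma named_ext xs ys M ms : named xs M ms -> named (xs ++ ys) M ms.
Proof.
elim: M ms => [|i M IH] ms; first by case: ms.
case/named_cons => x [ms' [-> Hx Hm]].
by rewrite /named /= (onth_ext ys Hx) [map _ M](IH _ Hm).
Qed.

Lemma named_mem xs M ms i : named xs M ms -> i \in M ->
  exists2 x, onth xs i = Some x & x \in ms.
Proof.
elim: M ms => // j M IH ms /named_cons[x [ms' [-> Hx Hm]]].
rewrite inE => /orP[/eqP-> | /(IH _ Hm)[y Hy yM]]; first by exists x; rewrite ?inE ?eqxx.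
by exists y; rewrite // inE yM orbT.
Qed.

Lemma named_mem_rev xs M ms x : named xs M ms -> x \in ms ->
  exists2 i, i \in M & onth xs i = Some x.
Proof.
elim: M ms => [|j M IH] ms; first by case: ms.
case/named_cons => y [ms' [-> Hy Hm]].
rewrite inE => /orP[/eqP-> | /(IH _ Hm)[i iM Hi]]; first by exists j; rewrite ?inE ?eqxx.
by exists i; rewrite // inE iM orbT.
Qed.

Lemma named_uniq xs M ms : uniq xs -> uniq M -> named xs M ms -> uniq ms.
Proof.
move=> uxs; elim: M ms => [|i M IH] ms; first by case: ms.
case/andP => iM uM /named_cons[x [ms' [-> Hx Hm]]] /=.
rewrite (IH _ uM Hm) andbT; apply/negP => /(named_mem_rev Hm)[j jM Hj].
by rewrite (onth_uniq uxs Hx Hj) jM in iM.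
Qed.

Lemma named_exist xs M (Q : T -> Prop) :
  (forall i, i \in M -> exists2 x, onth xs i = Some x & Q x) ->
  exists2 ms, named xs M ms & forall x, x \in ms -> Q x.
Proof.
elim: M => [|i M IH] H; first by exists [::].
have [x Hx Qx] := H i (mem_head _ _).
have [|ms Hm Qm] := IH; first by move=> j jM; apply: H; rewrite inE jM orbT.
exists (x :: ms); first by rewrite /named /= Hx [map _ M]Hm.
by move=> y; rewrite inE => /orP[/eqP->|/Qm].
Qed.

Lemma same_named xs M N ms ns : uniq xs -> named xs M ms -> named xs N ns ->
  same_names M N -> ms =i ns.
Proof.
move=> uxs HM HN /andP[/allP MN /allP NM] x; apply/idP/idP.
- case/(named_mem_rev HM) => i /MN; rewrite mem_nameE => iN Hi.
  by have [y Hy] := named_mem HN iN; move: Hi; rewrite Hy => -[->].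
- case/(named_mem_rev HN) => i /NM; rewrite mem_nameE => iM Hi.
  by have [y Hy] := named_mem HM iM; move: Hi; rewrite Hy => -[->].
Qed.

End Names.

Section Letter.
Variables (T : finType) (g : T -> T) (sz : bool -> nat) (cl : T -> option bool) (hs : seq T).
Hypothesis ker : kernel g sz cl hs.

Definition key_of (xs : seq T) (k : key) (x : T) : Prop :=
  match k with
  | Single i => onth xs i = Some x /\ cl x = None
  | Class b => cl x = Some b
  end.

Record depicts (xs : seq T) (l : letter) : Prop := Depicts {
  dep_sizes : sizes l = sz;
  dep_uniq : uniq (unzip1 (labels l));
  dep_labels : forall p, p \in labels l -> exists2 x, onth xs p.1 = Some x & cl x = p.2;
  dep_holes : forall h, holes l = Some h -> named xs h hs;
  dep_moves : forall k t, (k, t) \in moves l ->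
    exists x, key_of xs k x /\ onth xs t = Some (g x)
}.

Lemma key_of_ext xs ys k x : key_of xs k x -> key_of (xs ++ ys) k x.
Proof. by case: k => //= i [/(onth_ext ys)]. Qed.

Lemma depicts_ext xs ys l : depicts xs l -> depicts (xs ++ ys) l.
Proof.
case=> H1 H2 H3 H4 H5; split=> //.
- by move=> p /H3[x /(onth_ext ys) Hx]; exists x.
- by move=> h /H4/(named_ext ys).
- move=> k t /H5[x [/(key_of_ext ys) Hk /(onth_ext ys) Ht]].
  by exists x.
Qed.

Lemma key_of_fun xs k x y : key_of xs k x -> key_of xs k y -> g x = g y.
Proof.
case: k => [i [Hx _] [Hy _]|b /= Hx Hy]; first by move: Hy; rewrite Hx => -[->].
by apply/(kernel_eq ker); right; rewrite Hx Hy.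
Qed.

Lemma key_of_inj xs k k' x y : uniq xs ->
  key_of xs k x -> key_of xs k' y -> g x = g y -> k = k'.
Proof.
move=> uxs Hx Hy /(kernel_eq ker) E.
case: k Hx => [i [Hi Ni]|b /= Hb]; case: k' Hy => [j [Hj Nj]|c /= Hc].
- case: E => [E|[]]; last by rewrite Ni.
  by rewrite -E in Hj; rewrite (onth_uniq uxs Hi Hj).
- by case: E => [E|[]]; [move: Hc; rewrite -E Ni | rewrite Ni].
- by case: E => [E|[_ E]]; [move: Hb; rewrite E Nj | move: Hb; rewrite E Nj].
- by case: E => [E|[_ E]]; move: Hc; rewrite -E Hb => -[->].
Qed.

Lemma label_ofP i s : if label_of i s is Some b then (i, b) \in s else i \notin unzip1 s.
Proof.
elim: s => //= -[j b] s; rewrite eqn_eq; case: (i =P j) => [->|ij]; first by rewrite mem_head.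
case: (label_of i s) => [c|]; first by rewrite inE => ->; rewrite orbT.
by rewrite inE negb_or /= => ->; case: eqP.
Qed.

Lemma move_ofP k s : if move_of k s is Some t then (k, t) \in s else k \notin unzip1 s.
Proof.
elim: s => //= -[l b] s; rewrite eq_keyE; case: (k =P l) => [->|ij]; first by rewrite mem_head.
case: (move_of k s) => [c|]; first by rewrite inE => ->; rewrite orbT.
by rewrite inE negb_or /= => ->; case: eqP.
Qed.

Lemma in_classE b o : in_class b o = (o == Some b).
Proof. by case: o => //= c; rewrite eq_sym. Qed.

Lemma leq_size_class (b : bool) (ms : seq T) : uniq ms ->
  (forall x, x \in ms -> cl x = Some b) -> size ms <= sz b.
Proof.
move=> ums H; rewrite -(kernel_size ker) -(card_uniqP ums).
by apply/subset_leq_card/subsetP => x /H; rewrite inE => ->.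
Qed.

(** A class is never overfull: the named members of a class are distinct states
    of it. *)
Lemma room_ok xs l i x b : uniq xs -> depicts xs l -> onth xs i = Some x ->
  label_of i (labels l) = None -> cl x = Some b -> room l b.
Proof.
move=> uxs dep Hi Ni Hb; rewrite /room (dep_sizes dep).
pose M := i :: unzip1 [seq p <- labels l | in_class b p.2].
have subM : {subset unzip1 [seq p <- labels l | in_class b p.2] <= unzip1 (labels l)}.
  by move=> j /mapP[p]; rewrite mem_filter => /andP[_ pl] ->; apply: map_f.
have uM : uniq M.
  rewrite /M /=; have := label_ofP i (labels l); rewrite Ni => Nl.
  apply/andP; split; first by apply: contra Nl => /subM.
  apply: subseq_uniq (dep_uniq dep); apply: map_subseq; exact: filter_subseq.
have [|ms Hms clm] := @named_exist T xs M (fun x => cl x = Some b).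
  move=> j; rewrite inE => /orP[/eqP->|/mapP[p]]; first by exists x.
  rewrite mem_filter in_classE => /andP[/eqP E /(dep_labels dep)[y Hy Ey]] ->.
  by exists y; rewrite // Ey.
have := leq_size_class (named_uniq uxs uM Hms) clm.
by rewrite -(named_size Hms) /M /= size_map size_filter.
Qed.

Lemma add_label_depicts xs l i x : depicts xs l -> onth xs i = Some x ->
  label_of i (labels l) = None -> depicts xs (add_label l i (cl x)).
Proof.
case=> H1 H2 H3 H4 H5 Hi Ni; split=> //=.
- by have := label_ofP i (labels l); rewrite Ni H2 => ->.
- by move=> p; rewrite inE => /orP[/eqP->|/H3] //; exists x.
Qed.

Lemma label_all_ok xs l M : uniq xs -> depicts xs l ->
  (forall i, i \in M -> exists x, onth xs i = Some x) ->
  exists l', [/\ List.In l' (label_all l M), depicts xs l' &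
    forall i, (i \in M) || isSome (label_of i (labels l)) -> isSome (label_of i (labels l'))].
Proof.
move=> uxs; elim: M l => [|i M IH] l dep HM; first by exists l; split=> //; left.
have [x Hx] := HM i (mem_head _ _).
have HM' j : j \in M -> exists x, onth xs j = Some x.
  by move=> jM; apply: HM; rewrite inE jM orbT.
case E: (label_of i (labels l)) => [b|].
  have [l' [Hin dep' Hl]] := IH l dep HM'; exists l'; split=> //.
    by rewrite /= E /= List.app_nil_r.
  move=> j Hj; apply: Hl; move: Hj; rewrite inE.
  by case: eqP => [->|]; rewrite /= ?E ?orbT.
have dep1 := add_label_depicts dep Hx E.
have [l' [Hin dep' Hl]] := IH _ dep1 HM'; exists l'; split=> //.
  rewrite /= E; apply/List.in_flat_map; exists (add_label l i (cl x)); split=> //.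
  case Ecl: (cl x) => [b|]; last by left.
  right; have Hr := room_ok uxs dep Hx E Ecl.
  case: b Ecl Hr => Ecl Hr; rewrite /= Hr /=; last by left.
  by case: (room l false) => /=; [right; left | left].
move=> j Hj; apply: Hl => /=; move: Hj; rewrite inE eqn_eq.
by case: eqP; rewrite ?orbT.
Qed.

(** The states whose image has all its preimages in [ms]. *)
Definition doomed (ms : seq T) (x : T) : Prop :=
  x \in ms /\ forall b, cl x = Some b -> forall y, cl y = Some b -> y \in ms.

(** The keys computed from labels designate, once each, the classes whose image
    is lost; a full class is recognised by counting its members in [ms]. *)
Lemma keys_ok xs l M ms : uniq xs -> depicts xs l -> uniq ms -> named xs M ms ->
  (forall i, i \in M -> isSome (label_of i (labels l))) ->
  exists rs, [/\ List.Forall2 (key_of xs) (keys_of l M) rs, uniq (map g rs),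
    (forall x, x \in rs -> doomed ms x) &
    (forall x, doomed ms x -> g x \in map g rs)].
Proof.
move=> uxs dep ums Hms Hlab.
have labE i x : i \in M -> onth xs i = Some x -> lab l i = cl x.
  move=> iM Hi; have := label_ofP i (labels l); rewrite /lab.
  have := Hlab i iM; case: (label_of i (labels l)) => //= b _ /(dep_labels dep) /=.
  by case=> y; rewrite Hi => -[->] ->.
have cnt b : count (fun i => in_class b (lab l i)) M = count (fun x => cl x == Some b) ms.
  have: {in M, forall i x, onth xs i = Some x -> lab l i = cl x} by move=> i iM x; apply: labE.
  elim: (M) (ms) Hms => [|i M' IH] ms'; first by case: ms'.
  case/named_cons => x [ms1 [-> Hx Hm]] Hl /=.
  rewrite in_classE (Hl i (mem_head _ _) x Hx) (IH _ Hm) //.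
  by move=> j jM; apply: Hl; rewrite inE jM orbT.
have cntE b : count (fun x => cl x == Some b) ms = #|[set x | cl x == Some b] :&: [set x in ms]|.
  rewrite -size_filter -(card_uniqP (filter_uniq _ ums)).
  by apply: eq_card => x; rewrite !inE mem_filter.
have full b : reflect (forall y, cl y = Some b -> y \in ms)
     (eqn (count (fun i => in_class b (lab l i)) M) (sizes l b)).
  rewrite eqn_eq (dep_sizes dep) cnt cntE -(kernel_size ker b).
  apply: (iffP eqP) => [E y Hy|H].
    have {}E: [set x | cl x == Some b] :&: [set x in ms] = [set x | cl x == Some b].
      by apply/eqP; rewrite eqEcard subsetIl E leqnn.
    have: y \in [set x | cl x == Some b] by rewrite inE Hy.
    by rewrite -E !inE => /andP[].
  by congr #|pred_of_set _|; apply/setIidPl/subsetP => y; rewrite !inE => /eqP/H.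
pose ck b := (0 < sizes l b) && eqn (count (fun i => in_class b (lab l i)) M) (sizes l b).
have repr b : ck b -> exists2 x, cl x = Some b & doomed ms x.
  case/andP => + /full H.
  rewrite (dep_sizes dep) -(kernel_size ker) => /card_gt0P[x].
  rewrite inE => /eqP Hx.
  by exists x => //; split; [apply: H | move=> c; rewrite Hx => -[<-]].
have [rs1 H1 D1] : exists2 rs, List.Forall2 (key_of xs) [seq Single i | i <- M & ~~ isSome (lab l i)] rs
    & rs = [seq x <- ms | cl x == None].
  exists [seq x <- ms | cl x == None] => //.
  elim: (M) (ms) Hms labE {Hlab cnt cntE full ck repr ums} => [|i M' IH] ms'; first by case: ms' => //; constructor.
  case/named_cons => x [ms1 [-> Hx Hm]] Hl /=.
  have E := Hl i x (mem_head _ _) Hx.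
  have IH' := IH _ Hm (fun j y jM => Hl j y (@mem_behead _ (i :: M') j jM)).
  rewrite E; case Ex: (cl x) => [b|] //=.
  by constructor.
have [rs2 H2 D2] : exists2 rs, List.Forall2 (key_of xs) [seq Class b | b <- [:: false; true] & ck b] rs
    & forall x, x \in rs -> exists2 b, cl x = Some b & doomed ms x.
  elim: [:: false; true] => [|b s [rs Hr Dr]] /=; first by exists [::] => //; constructor.
  case Eb: (ck b); last by exists rs.
  have [x Hx dx] := repr b Eb.
  exists (x :: rs); first by constructor.
  by move=> y; rewrite inE => /orP[/eqP->|/Dr] //; exists b.
exists (rs1 ++ rs2).
have HH : List.Forall2 (key_of xs) (keys_of l M) (rs1 ++ rs2) by apply: List.Forall2_app.
have uk : uniq (keys_of l M).
  rewrite cat_uniq; apply/and3P; split.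
  - rewrite map_inj_uniq; last by move=> i j [].
    apply: filter_uniq; have: uniq (map (onth xs) M) by rewrite Hms map_inj_uniq // => x y [].
    exact: map_uniq.
  - by apply/hasPn => k /mapP[b _ ->]; apply/negP => /mapP[].
  - by rewrite map_inj_uniq ?filter_uniq // => b c [].
split=> //.
- elim: HH uk => //= k x ks rs kx Hks IH /andP[Nk uks]; rewrite IH // andbT.
  apply: contra Nk => /mapP[y yrs E].
  elim: Hks yrs {IH uks} => //= k' x' ks' rs' k'x' _ IH'.
  rewrite inE => /orP[/eqP Ey|/IH' kks]; last by rewrite inE kks orbT.
  by rewrite Ey in E; rewrite (key_of_inj uxs kx k'x' E) mem_head.
- move=> x; rewrite mem_cat => /orP[|/D2[b _]] //.
  rewrite D1 mem_filter => /andP[/eqP Nx xms]; split=> // b; by rewrite Nx.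
- move=> x [xms Dx]; case Ex: (cl x) => [b|]; last first.
    by apply: map_f; rewrite mem_cat D1 mem_filter Ex xms.
  have: Class b \in keys_of l M.
    rewrite mem_cat; apply/orP; right; apply: map_f; rewrite mem_filter.
    apply/andP; split; last by case: (b).
    apply/andP; split; last by apply/full => y Hy; apply: (Dx b).
    by rewrite (dep_sizes dep) -(kernel_size ker); apply/card_gt0P; exists x; rewrite inE Ex.
  move=> Hk; have [y yrs Hy] : exists2 y, y \in rs1 ++ rs2 & cl y = Some b.
    elim: HH Hk {uk} => //= k y ks rs ky _ IH.
    rewrite inE => /orP[/eqP Ek|/IH[z zrs Hz]]; first by exists y; rewrite ?mem_head // -Ek in ky *.
    by exists z; rewrite // inE zrs orbT.
  apply/mapP; exists y => //; apply/(kernel_eq ker); right; by rewrite Ex Hy.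
Qed.

End Letter.

(** * Exhaustiveness of the case split *)

Lemma mem_In (A : eqType) (x : A) s : x \in s -> List.In x s.
Proof. by elim: s => //= y s IH; rewrite inE => /orP[/eqP->|/IH]; [left|right]. Qed.

Lemma In_map_filter (A : eqType) (B : Type) (F : A -> B) (p : pred A) s x :
  x \in s -> p x -> List.In (F x) [seq F y | y <- s & p y].
Proof. by move=> xs px; apply/List.in_map/mem_In; rewrite mem_filter px. Qed.

Section Letter.
Variables (T : finType) (f : bool -> T -> T) (c0 : bool).
Let g := f c0.
Variables (sz : bool -> nat) (cl : T -> option bool) (hs : seq T).
Hypothesis ker : kernel g sz cl hs.
Notation depicts := (depicts g sz cl hs).

Lemma fresh_names_ok (xs qs : seq T) : uniq xs -> uniq qs ->
  exists h n ys, [/\ List.In (h, n) (fresh_names (size qs) (size xs)),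
    n = size (xs ++ ys), uniq (xs ++ ys) & named (xs ++ ys) h qs].
Proof.
move=> uxs; elim/last_ind: qs => [|qs q IH].
  by move=> _; exists [::], (size xs), [::]; rewrite cats0; split=> //; left.
rewrite rcons_uniq => /andP[qN uq].
have [h [n [ys [Hin En u Hh]]]] := IH uq.
rewrite size_rcons /=.
case: (boolP (q \in xs ++ ys)) => [/onthP[i Hi]|qnew].
  exists (rcons h i), n, ys; split=> //; last by rewrite /named !map_rcons Hi [map _ h]Hh.
  apply/List.in_flat_map; exists (h, n); split=> //.
  apply/List.in_or_app; left; apply: (@In_map_filter _ _ (fun i => (rcons h i, n))).
    by rewrite mem_iota /= add0n En (onth_size Hi).
  rewrite mem_nameE; apply: contra qN => /(named_mem Hh)[y].
  by rewrite Hi => -[->].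
exists (rcons h n), n.+1, (rcons ys q); rewrite -rcons_cat; split.
- apply/List.in_flat_map; exists (h, n); split=> //.
  by apply/List.in_or_app; right; left.
- by rewrite size_rcons En.
- by rewrite rcons_uniq qnew.
- rewrite -cats1 /named !map_rcons [map _ h](named_ext [:: q] Hh).
  by rewrite En onth_last.
Qed.

Lemma name_holes_ok (xs : seq T) l : uniq xs -> depicts xs l ->
  exists h n l' ys, [/\ List.In (h, (n, l')) (name_holes (size xs) l),
    n = size (xs ++ ys), uniq (xs ++ ys), depicts (xs ++ ys) l' & holes l' = Some h].
Proof.
move=> uxs dep; rewrite /name_holes; case Eh: (holes l) => [h|].
  by exists h, (size xs), l, [::]; rewrite cats0; split=> //; left.
have [h [n [ys [Hin En u Hh]]]] := fresh_names_ok uxs (kernel_uniq ker).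
exists h, n, (set_holes l h), ys; split=> //.
  rewrite /defect (dep_sizes dep) -(kernel_defect ker).
  by apply/List.in_map_iff; exists (h, n).
have [D1 D2 D3 D4 D5] := depicts_ext ys dep; split=> //.
by move=> h' [<-].
Qed.

Lemma add_move_depicts (xs : seq T) l k t x : depicts xs l ->
  key_of cl xs k x -> onth xs t = Some (g x) -> depicts xs (add_move l k t).
Proof.
case=> D1 D2 D3 D4 D5 kx Ht; split=> //= k' t'.
rewrite inE => /orP[/eqP[-> ->]|/D5] //; by exists x.
Qed.

(** The image of a key is an already named state or a new one; a named state is
    excluded if it is a hole or the image of another key. *)
Lemma name_targets_ok ks (xs rs : seq T) l h : uniq xs -> depicts xs l ->
  holes l = Some h -> List.Forall2 (key_of cl xs) ks rs ->
  exists ts n l' ys, [/\ List.In (ts, (n, l')) (name_targets h (size xs) l ks),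
    n = size (xs ++ ys), uniq (xs ++ ys), depicts (xs ++ ys) l' &
    holes l' = Some h /\ named (xs ++ ys) ts (map g rs)].
Proof.
elim: ks xs rs l => [|k ks IH] xs rs l uxs dep Hh HF.
  inversion HF; subst; exists [::], (size xs), l, [::].
  by rewrite cats0; split=> //; left.
inversion HF as [|k' x ks' rs' kx HF' E1 E2]; subst.
suff [t [n [l1 [ys [Hin En u dep1 [Hh1 Ht]]]]]] :
  exists t n l1 ys, [/\ List.In (t, (n, l1)) (match move_of k (moves l) with
       | Some t => [:: (t, (size xs, l))]
       | None =>
         (size xs, ((size xs).+1, add_move l k (size xs))) ::
         [seq (t, (size xs, add_move l k t)) |
            t <- iota 0 (size xs) & ~~ mem_name t h && ~~ has (fun m => eqn t m.2) (moves l)]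
       end), n = size (xs ++ ys), uniq (xs ++ ys), depicts (xs ++ ys) l1 &
       holes l1 = Some h /\ onth (xs ++ ys) t = Some (g x)].
  have HF1 : List.Forall2 (key_of cl (xs ++ ys)) ks rs'.
    elim: HF' {IH HF} => //= k1 x1 ks1 rs1 kx1 _ ih; constructor=> //.
    exact: key_of_ext.
  have [ts [n' [l' [zs [Hin' En' u' dep' [Hh' Hts]]]]]] := IH _ _ _ u dep1 Hh1 HF1.
  exists (t :: ts), n', l', (ys ++ zs); rewrite catA; split=> //.
    rewrite /= ; apply/List.in_flat_map; exists (t, (n, l1)); split=> //.
    by apply/List.in_map_iff; exists (ts, (n', l')); rewrite En.
  by split=> //; rewrite /named /= (onth_ext zs Ht) [map _ ts]Hts.
case Em: (move_of k (moves l)) => [t|].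
  exists t, (size xs), l, [::]; rewrite cats0; split=> //; first by left.
  split=> //; have := move_ofP k (moves l); rewrite Em => /(dep_moves dep)[y [ky ->]].
  by rewrite (key_of_fun ker ky kx).
case: (boolP (g x \in xs)) => [/onthP[t Ht]|xnew].
  exists t, (size xs), (add_move l k t), [::]; rewrite cats0; split=> //; last first.
    exact: add_move_depicts Ht.
  right; apply: (@In_map_filter _ _ (fun t => (t, (size xs, add_move l k t)))).
    by rewrite mem_iota /= add0n (onth_size Ht).
  apply/andP; split.
    rewrite mem_nameE; apply/negP => /(named_mem (dep_holes dep Hh))[y].
    rewrite Ht => -[<-]; rewrite (kernel_hole ker) => /negP; apply.
    exact: codom_f.
  apply/negP => /hasP[[k' t'] kt'] /=; rewrite eqn_eq => /eqP Et; subst t'.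
  have [y [ky]] := dep_moves dep kt'; rewrite Ht => -[E].
  have Ek := key_of_inj ker uxs kx ky E; subst k'.
  have := move_ofP k (moves l); rewrite Em => /negP; apply.
  by apply/mapP; exists (k, t).
exists (size xs), (size xs).+1, (add_move l k (size xs)), [:: g x]; split.
- by left.
- by rewrite size_cat addn1.
- by rewrite cat_uniq uxs /= orbF xnew.
- apply: (@add_move_depicts _ _ _ _ x); [exact: depicts_ext | exact: key_of_ext |].
  exact: onth_last.
- by rewrite onth_last.
Qed.

(** The lost states are the holes and the images of the classes contained in the
    lost set before. *)
Lemma lost_doomed (ms : seq T) q :
  q \in lost f c0 [set x in ms] <-> q \in hs \/ exists2 x, doomed cl ms x & g x = q.
Proof.
rewrite inE (kernel_hole ker); split.
- move/forallP => H; case: (boolP (q \in codom g)) => [/codomP[x Ex]|]; last by left.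
  right; exists x => //; split.
    by have := H x; rewrite inE -/g -Ex eqxx.
  move=> b Hb y Hy; have := H y; rewrite inE -/g.
  have -> : g y = q by rewrite Ex; apply/(kernel_eq ker); right; rewrite Hb Hy.
  by rewrite eqxx.
- move=> H; apply/forallP => p; apply/implyP => /eqP Ep; rewrite inE.
  case: H => [/negP[]|[x [xms Dx] Ex]]; first by rewrite -Ep codom_f.
  move: Ep; rewrite -Ex => /(kernel_eq ker)[-> //|[Np E]].
  case Eb: (cl p) Np => [b|] // _.
  by apply: (Dx b) => //; rewrite -E.
Qed.

Lemma letter_step (xs ms : seq T) l M : uniq xs -> depicts xs l -> uniq ms -> named xs M ms ->
  exists2 l1, List.In l1 (label_all l M) &
    if 2 < defect l1 + size (keys_of l1 M) then
       depicts xs l1 /\ 2 < #|lost f c0 [set x in ms]|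
    else exists x y ys, [/\ List.In x (name_holes (size xs) l1),
      List.In y (name_targets x.1 x.2.1 x.2.2 (keys_of l1 M)),
      y.2.1 = size (xs ++ ys), uniq (xs ++ ys) & depicts (xs ++ ys) y.2.2 /\
      exists ns, [/\ uniq ns, named (xs ++ ys) (x.1 ++ y.1) ns &
        lost f c0 [set x in ms] = [set x in ns]]].
Proof.
move=> uxs dep ums Hms.
have [|l1 [Hl1 dep1 lab1]] := label_all_ok ker (M := M) uxs dep.
  by move=> i /(named_mem Hms)[x Hx _]; exists x.
exists l1 => //.
have [|rs [HF urs Drs rsD]] := keys_ok ker uxs dep1 ums Hms.
  by move=> i iM; apply: lab1; rewrite iM.
have lostE : lost f c0 [set x in ms] = [set q in hs ++ map g rs].
  apply/setP => q; rewrite [in RHS]inE mem_cat; apply/idP/idP.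
    by case/lost_doomed => [->//|[x /rsD + <-]] => ->; rewrite orbT.
  move=> H; apply/lost_doomed; case/orP: H => [->|/mapP[x /Drs Dx ->]]; first by left.
  by right; exists x.
have uall : uniq (hs ++ map g rs).
  rewrite cat_uniq (kernel_uniq ker) urs andbT; apply/hasPn => q /mapP[x _ ->].
  by rewrite (kernel_hole ker) negbK codom_f.
case: ifP => [big|_].
  split=> //; rewrite lostE cardsE (card_uniqP uall) size_cat size_map.
  rewrite (kernel_defect ker) -(dep_sizes dep1) -/(defect l1).
  have -> : size rs = size (keys_of l1 M) by elim: HF => //= k x ks rs' _ _ ->.
  by [].
have [h [n [l2 [ys [Hin En u dep2 Hh]]]]] := name_holes_ok uxs dep1.
have HF2 : List.Forall2 (key_of cl (xs ++ ys)) (keys_of l1 M) rs.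
  elim: HF => //= k1 x1 ks1 rs1 kx1 _ ih; constructor=> //.
  exact: key_of_ext.
have [ts [n' [l3 [zs [Hin3 En3 u3 dep3 [Hh3 Hts]]]]]] := name_targets_ok u dep2 Hh HF2.
exists (h, (n, l2)), (ts, (n', l3)), (ys ++ zs); rewrite catA; split=> //=.
  by rewrite En.
split=> //; exists (hs ++ map g rs); split=> //.
rewrite /named !map_cat [map _ ts]Hts; congr (_ ++ _).
exact: (named_ext zs (dep_holes dep2 Hh)).
Qed.

End Letter.

Section Sketch.
Variables (T : finType) (f : bool -> T -> T).
Variables (sz : bool -> bool -> nat) (cl : bool -> T -> option bool) (hs : bool -> seq T).
Hypothesis ker : forall c, kernel (f c) (sz c) (cl c) (hs c).

Record models (xs : seq T) (P : sketch) : Prop := Models {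
  mod_uniq : uniq xs;
  mod_bound : bound P = size xs;
  mod_letter : forall c, depicts (f c) (sz c) (cl c) (hs c) xs (letters P c)
}.

Lemma set_letter_models xs ys P c n l : models xs P -> n = size (xs ++ ys) ->
  uniq (xs ++ ys) -> depicts (f c) (sz c) (cl c) (hs c) (xs ++ ys) l ->
  models (xs ++ ys) (set_letter n P c l).
Proof.
case=> uxs En dep E u dl; split=> // d /=.
by case: c dl => dl; case: d => //=; apply: depicts_ext.
Qed.

(** The case split is exhaustive: the names of an automaton described by [P] can
    be extended to one of the completions, which predicts the lost set. *)
Lemma step_ok xs P M ms c : models xs P -> uniq ms -> named xs M ms ->
  exists P' o ys, [/\ List.In (P', o) (step P M c), models (xs ++ ys) P' &
    match o with
    | None => 2 < #|lost f c [set x in ms]|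
    | Some M' => exists ns, [/\ uniq ns, named (xs ++ ys) M' ns &
        lost f c [set x in ms] = [set x in ns]]
    end].
Proof.
move=> mP ums Hms.
have [l1 Hl1] := letter_step (ker c) (mod_uniq mP) (mod_letter mP c) ums Hms.
case: ifP => [big [dep1 L3]|small [x [y [ys [Hx Hy Ey u [dy [ns [uns Hns E]]]]]]]].
  exists (set_letter (bound P) P c l1), None, [::]; split=> //.
    by apply/List.in_flat_map; exists l1; split=> //; cbv beta zeta; rewrite big; left.
  apply: set_letter_models => //; rewrite ?cats0 ?(mod_uniq mP) //.
  by rewrite (mod_bound mP).
exists (set_letter y.2.1 P c y.2.2), (Some (x.1 ++ y.1)), ys; split.
- apply/List.in_flat_map; exists l1; split=> //; cbv beta zeta; rewrite small.
  apply/List.in_flat_map; exists x; split; first by rewrite (mod_bound mP).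
  case: x Hx Hy {Hns} => h [n l'] _ /= Hy.
  by apply/List.in_map_iff; exists y.
- exact: set_letter_models.
- by exists ns.
Qed.

End Sketch.

(** * Correctness of the exploration *)

Lemma all_In (A : Type) (p : A -> bool) s x : all p s -> List.In x s -> p x.
Proof. by elim: s => //= y s IH /andP[py ps] [<- | /IH]; last exact. Qed.

Section Sound.
Variables (T : finType) (f : bool -> T -> T).
Variables (sz : bool -> bool -> nat) (cl : bool -> T -> option bool) (hs : bool -> seq T).
Hypothesis ker : forall c, kernel (f c) (sz c) (cl c) (hs c).
Notation models := (models f sz cl hs).

Definition den (xs : seq T) (M : seq nat) : {set T} :=
  [set x | has (fun i => onth xs i == Some x) M].

Lemma denE xs M ms : named xs M ms -> den xs M = [set x in ms].
Proof.
move=> Hms; apply/setP => x; rewrite !inE; apply/hasP/idP.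
  by case=> i iM /eqP Hi; have [y] := named_mem Hms iM; rewrite Hi => -[<-].
by case/(named_mem_rev Hms) => i iM Hi; exists i => //; apply/eqP.
Qed.

(** Induction on words: each missed set is that of some element of [seen]. *)
Lemma settled_ok fuel xs P seen todo :
  models xs P -> settled fuel P seen todo ->
  (forall M, M \in seen -> (exists2 ms, uniq ms & named xs M ms) /\ size M <= 2) ->
  (forall M c, (M, c) \in todo -> M \in seen) ->
  (forall M c, M \in seen ->
     (M, c) \in todo \/ exists2 N, N \in seen & lost f c (den xs M) = den xs N) ->
  [::] \in seen ->
  forall u, #|missed f u| <= 2.
Proof.
elim: fuel xs P seen todo => // fuel IH xs P seen [|[M c] todo] mP /=.
  move=> _ Hseen _ Hstep Hnil u.
  suff [M /Hseen[[ms ums Hms] sM] ->] : exists2 M, M \in seen & missed f u = den xs M.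
    by rewrite (denE Hms) cardsE (card_uniqP ums) -(named_size Hms).
  elim/last_ind: u => [|u c [M Ms E]].
    by exists [::] => //; rewrite missed_nil; apply/setP => x; rewrite !inE.
  by case: (Hstep M c Ms) => // -[N Ns EN]; exists N; rewrite // missed_rcons E.
move=> Hall Hseen Htodo Hstep Hnil.
have Ms : M \in seen by apply: (Htodo M c); rewrite mem_head.
have [[ms ums Hms] _] := Hseen M Ms.
have [P' [o [ys [Hin mP' Ho]]]] := step_ok ker c mP ums Hms.
have := all_In Hall Hin; case: o Hin Ho => // M' Hin [ns [uns Hns E]] /andP[sM'].
have denX N : N \in seen -> den (xs ++ ys) N = den xs N.
  case/Hseen => -[ns' _ Hns'] _.
  by rewrite (denE Hns') (denE (named_ext ys Hns')).
have seen_ext N : N \in seen -> (exists2 ms, uniq ms & named (xs ++ ys) N ms) /\ size N <= 2.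
  by case/Hseen => -[ns' u' /(named_ext ys) Hns'] sN; split=> //; exists ns'.
have EM : lost f c (den (xs ++ ys) M) = den (xs ++ ys) M'.
  by rewrite denX // (denE Hms) (denE Hns).
case: ifP => [/hasP[N Ns same]|_] Hcl.
  apply: (IH _ _ _ _ mP' Hcl) => //.
  - by move=> N' c' N't; apply: (Htodo N' c'); rewrite inE N't orbT.
  - move=> N' c' N's; case: (Hstep N' c' N's) => [|[N2 N2s E2]]; last first.
      by right; exists N2; rewrite // !denX.
    rewrite inE => /orP[/eqP[-> ->]|]; last by left.
    right; exists N => //; rewrite EM.
    have [[ns' _ Hns'] _] := seen_ext N Ns.
    rewrite (denE Hns) (denE Hns'); apply/setP => x; rewrite !inE.
    exact: (same_named (mod_uniq mP') Hns Hns' same).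
apply: (IH _ _ _ _ mP' Hcl).
- move=> N; rewrite inE => /orP[/eqP->|/seen_ext //]; split=> //.
  by exists ns.
- move=> N c'; rewrite mem_cat => /orP[N't|].
    by rewrite inE (Htodo N c') ?orbT // inE N't orbT.
  by rewrite !inE => /orP[]/eqP[-> _]; rewrite eqxx.
- move=> N c'; rewrite inE => /orP[/eqP->|Ns].
    by left; rewrite mem_cat !inE; case: c'; rewrite eqxx ?orbT.
  case: (Hstep N c' Ns) => [|[N2 N2s E2]]; last first.
    by right; exists N2; rewrite ?inE ?N2s ?orbT // !denX.
  rewrite inE => /orP[/eqP[-> ->]|Nt]; last by left; rewrite mem_cat Nt.
  by right; exists M'; rewrite ?mem_head.
- by rewrite inE Hnil orbT.
Qed.

Variable w0 : seq bool.
Hypothesis small : #|missed f w0| <= 2.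

Definition reached (X : {set T}) (ps : bitseq) : Prop :=
  forall i, nth false ps i -> X \subset missed f (take i w0).

Definition item_ok (xs : seq T) (it : item) : Prop :=
  let: (M, c, ps) := it in
  has id ps /\ exists ms, [/\ uniq ms, named xs M ms & reached (lost f c [set x in ms]) ps].

Lemma nth_advance c w ps i : nth false (advance c w ps) i ->
  [/\ nth false ps i, i < size w & nth false w i = c].
Proof.
elim: w ps i => [|d w IH] [|p ps] [|i] //=; first by clear IH; case: p c d => [] [] [].
by move/IH.
Qed.

Lemma nth_mask_diff p q i : nth false (mask_diff p q) i -> nth false p i.
Proof.
elim: p q i => [|b p IH] [|c q] [|i] //=; first by case/andP.
exact: IH.
Qed.

Lemma reached_spawn xs M ms ps it : uniq ms -> named xs M ms ->
  reached [set x in ms] ps -> it \in spawn w0 M ps -> item_ok xs it.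
Proof.
move=> ums Hms Hps.
have ok c : has id (false :: advance c w0 ps) -> item_ok xs (M, c, false :: advance c w0 ps).
  move=> Hh; split=> //; exists ms; split=> // -[|i] //= /nth_advance[Hi si Ei].
  rewrite (take_nth false si) Ei missed_rcons.
  exact: lostS (Hps i Hi).
rewrite /spawn /= -!/(has id (false :: _)).
case: ifP => [/ok H1|_]; case: ifP => [/ok H2|_] //; rewrite /= !inE.
- by case/orP=> /eqP->.
- by move/eqP->.
- by move/eqP->.
Qed.

Lemma item_ok_ext xs ys it : item_ok xs it -> item_ok (xs ++ ys) it.
Proof.
case: it => [[M c] ps] [Hh [ms [ums Hms Hr]]]; split=> //.
by exists ms; split=> //; apply: named_ext.
Qed.

Lemma survivors_in P M s : List.In (P, Some M) s -> List.In (P, M) (survivors s).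
Proof.
elim: s => //= -[P' [M'|]] s IH [[]|] //.
- by move=> -> ->; left.
- by move/IH; right.
Qed.

(** Since [w0] loses at most two states, so do its prefixes: the completions in
    which an item loses three do not describe the automaton at hand. *)
Lemma item_step xs P M c ps : models xs P -> item_ok xs (M, c, ps) ->
  exists P' M' ys ns, [/\ List.In (P', M') (survivors (step P M c)), models (xs ++ ys) P',
    uniq ns, named (xs ++ ys) M' ns & reached [set x in ns] ps].
Proof.
move=> mP [Hh [ms [ums Hms Hr]]].
have [P' [o [ys [Hin mP' Ho]]]] := step_ok ker c mP ums Hms.
case: o Hin Ho => [M'|] Hin Ho.
  case: Ho => ns [uns Hns E]; exists P', M', ys, ns; rewrite E in Hr; split=> //.
  exact: survivors_in.
have /hasP[b /(nthP false)[i si Ei] bt] := Hh; have := Hr i; rewrite Ei => /(_ bt) /subset_leq_card.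
move/(leq_trans Ho); have := leq_missed_factor f [::] (take i w0) (drop i w0).
rewrite /= cat_take_drop => H1 H2.
by have := leq_trans H2 (leq_trans H1 small).
Qed.

Lemma cheapest_in best rest : cheapest best rest \in [seq z.2 | z <- best :: rest].
Proof.
elim: rest best => [|x rest IH] best /=; first by rewrite mem_head.
case: ifP => _; have := IH x; have := IH best; rewrite !inE //=.
  by move=> _ ->; rewrite orbT.
by case/orP=> [->|->] //; rewrite !orbT.
Qed.

Lemma explore_ok fuel xs P known todo pend : models xs P ->
  explore w0 fuel P known todo pend ->
  (forall it, it \in todo -> item_ok xs it) ->
  (forall it, it \in [seq z.2 | z <- pend] -> item_ok xs it) ->
  forall u, #|missed f u| <= 2.
Proof.
elim: fuel xs P known todo pend => // fuel IH xs P known [|[[M c] ps] todo] pend mP.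
  case: pend => [|x pend] H _ Hpend.
    apply: (settled_ok mP H) => //.
    - by move=> M; rewrite inE => /eqP->; split=> //; exists [::].
    - by move=> M c; rewrite !inE => /orP[]/eqP[-> _].
    - by move=> M c; rewrite inE => /eqP->; left; case: c.
  move: H => /=; have := cheapest_in x pend.
  case: (cheapest x pend) => [[M c] ps] Hin Hall.
  have [P' [M' [ys [ns [Hs mP' uns Hns Hr]]]]] := item_step mP (Hpend _ Hin).
  apply: (IH _ _ _ _ _ mP' (all_In Hall Hs)) => // it Hit.
  exact/item_ok_ext/Hpend.
move=> /= H Htodo Hpend.
have okM : item_ok xs (M, c, ps) by apply: Htodo; rewrite mem_head.
have Htodo' it : it \in todo -> item_ok xs it by move=> Hit; apply: Htodo; rewrite inE Hit orbT.
have [P' [M' [ys [ns [Hs mP' uns Hns Hr]]]]] := item_step mP okM.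
case: (survivors (step P M c)) Hs H => [|[P1 M1] [|y s]] //.
  case=> // -[-> ->] H.
  have Hpend' it : it \in [seq z.2 | z <- pend] -> item_ok (xs ++ ys) it.
    by move=> Hit; apply/item_ok_ext/Hpend.
  have Htodo2 it : it \in todo -> item_ok (xs ++ ys) it.
    by move=> Hit; apply/item_ok_ext/Htodo'.
  move: H; case: ifP => _ H; last exact: (IH _ _ _ _ _ mP' H).
  apply: (IH _ _ _ _ _ mP' H) => // it; rewrite mem_cat => /orP[|/Htodo2 //].
  apply: reached_spawn uns Hns _.
  by move=> i /nth_mask_diff; apply: Hr.
move=> _ H; apply: (IH _ _ _ _ _ mP H) => // it.
by rewrite inE => /orP[/eqP->|/Hpend].
Qed.

End Sound.

(** * Kernels of letters of small deficiency *)

(** With [r] choosing a state in each kernel class, the set [D] of the states not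
    chosen has as many elements as there are states outside the image, so at
    most two; its elements determine the nontrivial classes. *)
Lemma kernel_exists (T : finType) (g : T -> T) : #|[predC codom g]| <= 2 ->
  exists2 s, List.In s shapes & exists cl hs, kernel g s cl hs.
Proof.
move=> le2; pose hs := enum [predC codom g].
have uhs : uniq hs by exact: enum_uniq.
have Hhs q : (q \in hs) = (q \notin codom g) by rewrite mem_enum.
pose r x := odflt x [pick p | g p == g x].
have gr x : g (r x) = g x.
  by rewrite /r; case: pickP => [p /eqP|] //=.
have req x y : g x = g y -> r x = r y.
  by rewrite /r => ->; case: pickP => [//|/(_ y)]; rewrite eqxx.
pose D := [set x | r x != x].
have cardD : #|D| = size hs.
  have imR : #|[set x | r x == x]| = #|codom g|.
    rewrite -(card_in_imset (f := g)); last first.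
      by move=> x y; rewrite !inE => /eqP Ex /eqP Ey /req; rewrite Ex Ey.
    apply: eq_card => q; apply/imsetP/codomP => [[x _ ->]|[x ->]]; first by exists x.
    by exists (r x); rewrite ?gr // inE (req _ x) ?gr.
  rewrite -cardE; apply/eqP; rewrite -(eqn_add2l #|codom g|) cardC -imR.
  rewrite -(cardsC [set x | r x == x]); apply/eqP; congr (_ + _).
  by apply: eq_card => x; rewrite !inE.
have notD x : x \notin D -> r x = x by rewrite inE negbK => /eqP.
have kerD x y : x \notin D -> y \notin D -> g x = g y -> x = y.
  by move=> /notD Ex /notD Ey /req; rewrite Ex Ey.
have rD x : r x \notin D by rewrite inE negbK (req _ x) ?gr.
have fiber z : #|[set x | g x == g z]| = #|[set x in D | g x == g z]|.+1.
  have -> : [set x | g x == g z] = r z |: [set x in D | g x == g z].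
    apply/setP => x; rewrite 4!inE.
    case: (g x =P g z) => [E|N]; rewrite ?andbT ?andbF ?orbF.
      by rewrite -(req _ _ E) eq_sym inE orbN.
    by apply/esym/eqP => Ex; apply: N; rewrite Ex gr.
  by rewrite cardsU1 !inE (req _ z) ?gr // eqxx.
have [D0|D_gt0] := posnP #|D|.
  exists (class_sizes 0 0); first by left.
  exists (fun=> None), hs; split=> //.
  - move=> x y; split=> [E|[->|[]]] //; left.
    by apply: kerD E; rewrite (cards0_eq D0) inE.
  - move=> b; rewrite (_ : [set _ | _] = set0) ?cards0; first by case: b.
    by apply/setP => x; rewrite !inE.
  - by rewrite -cardD D0.
have : #|D| <= 2 by rewrite cardD -cardE.
rewrite leq_eqVlt => /orP[D2|D1].
  have /cards2P[z1 [z2 [neq_z Dz]]] := D2.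
  have inD x : x \in D -> x = z1 \/ x = z2.
    by rewrite Dz !inE => /orP[]/eqP->; [left|right].
  have [Ez|Nz] := g z1 =P g z2.
    have outD x : (g x == g z1) = false -> x \notin D.
      by apply: contraFN => /inD[->|->]; rewrite ?eqxx // Ez.
    exists (class_sizes 3 0); first by right; right; left.
    exists (fun x => if g x == g z1 then Some false else None), hs; split=> //.
    - move=> x y; split=> [E|[->//|]].
        rewrite -E; case Ex: (g x == g z1); first by right.
        by left; apply: (kerD x y _ _ E); apply: outD; rewrite -?E.
      by case: (g x =P g z1) => [->|_] [] //; case: (g y =P g z1) => [->|].
    - case.
        rewrite (_ : [set _ | _] = set0) ?cards0 //.
        by apply/setP => x; rewrite !inE; case: ifP.
      rewrite (_ : [set _ | _] = [set x | g x == g z1]); last first.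
        by apply/setP => x; rewrite !inE; case: ifP.
      rewrite fiber (_ : [set x in D | _] = D) ?(eqP D2) //.
      apply/setP => x; rewrite [in LHS]inE; case: (boolP (x \in D)) => //.
      by case/inD => ->; rewrite ?eqxx // Ez eqxx.
    - by rewrite -cardD (eqP D2).
  have outD x : (g x == g z1) = false -> (g x == g z2) = false -> x \notin D.
    by move=> N1 N2; apply/negP => /inD[] E; [move: N1 | move: N2]; rewrite E eqxx.
  have fib1 : [set x in D | g x == g z1] = [set z1].
    apply/setP => x; rewrite inE Dz !inE; case: (x =P z1) => [->|_] /=.
      by rewrite eqxx.
    by case: (x =P z2) => [->|//] /=; apply/eqP => E; apply: Nz.
  have fib2 : [set x in D | g x == g z2] = [set z2].
    apply/setP => x; rewrite inE Dz !inE orbC; case: (x =P z2) => [->|_] /=.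
      by rewrite eqxx.
    by case: (x =P z1) => [->|//] /=; apply/eqP.
  exists (class_sizes 2 2); first by right; right; right; left.
  exists (fun x => if g x == g z1 then Some false else
                   if g x == g z2 then Some true else None), hs; split=> //.
  - move=> x y; split=> [E|[->//|]].
      rewrite -E; case Ex: (g x == g z1); first by right.
      case Ex2: (g x == g z2); first by right.
      by left; apply: (kerD x y _ _ E); apply: outD; rewrite -?E.
    case: (g x =P g z1) => [->|_].
      by case: (g y =P g z1) => [->//|_]; case: (g y =P g z2) => _ [].
    case: (g x =P g z2) => [->|_]; last by case.
    by case: (g y =P g z1) => [_|_] []; case: (g y =P g z2) => [->|].
  - case.
      rewrite (_ : [set _ | _] = [set x | g x == g z2]) ?fiber ?fib2 ?cards1 //.
      apply/setP => x; rewrite !inE; case: (g x =P g z1) => [->|_].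
        by apply/esym/eqP.
      by case: (g x =P g z2).
    rewrite (_ : [set _ | _] = [set x | g x == g z1]) ?fiber ?fib1 ?cards1 //.
    by apply/setP => x; rewrite !inE; case: (g x =P g z1) => //; case: (g x =P g z2).
  - by rewrite -cardD (eqP D2).
have {}D1 : #|D| == 1 by rewrite eqn_leq -ltnS D1.
have /cards1P[z Dz] := D1.
have outD x : (g x == g z) = false -> x \notin D.
  by apply: contraFN; rewrite Dz inE => /eqP->.
exists (class_sizes 2 0); first by right; left.
exists (fun x => if g x == g z then Some false else None), hs; split=> //.
- move=> x y; split=> [E|[->//|]].
    rewrite -E; case Ex: (g x == g z); first by right.
    by left; apply: (kerD x y _ _ E); apply: outD; rewrite -?E.
  by case: (g x =P g z) => [->|_] [] //; case: (g y =P g z) => [->|].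
- case.
    rewrite (_ : [set _ | _] = set0) ?cards0 //.
    by apply/setP => x; rewrite !inE; case: ifP.
  rewrite (_ : [set _ | _] = [set x | g x == g z]); last first.
    by apply/setP => x; rewrite !inE; case: ifP.
  rewrite fiber (_ : [set x in D | _] = D) ?(eqP D1) //.
  apply/setP => x; rewrite [in LHS]inE; case: (boolP (x \in D)) => //.
  by rewrite Dz inE => /eqP->; rewrite eqxx.
- by rewrite -cardD (eqP D1).
Qed.

(** If [w] does not compress an automaton, then each letter, being a factor of
    [w], has deficiency at most 2; so the automaton is described by one of the
    initial sketches, and the exploration shows that no word compresses it. *)
Theorem collapses_by_exploration w fuel :
  (forall c, exists v v', w = v ++ c :: v') ->
  all (fun sa => all (fun sb => collapses_shape w fuel sa sb) shapes) shapes ->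
  collapses w.
Proof.
move=> Hw Hall; split; first by case: w Hw Hall => // /(_ true)[[|? ?] []].
move=> T f u Hu; rewrite ltnNge; apply/negP => small.
have ker c : exists2 s, List.In s shapes & exists cl hs, kernel (f c) s cl hs.
  apply: kernel_exists; have [v [v' E]] := Hw c.
  have := leq_missed_factor f v [:: c] v'; rewrite -E => /leq_trans/(_ small).
  congr (_ <= _); rewrite /missed; apply: eq_card => q; rewrite !inE; congr (~~ _).
  by apply/imsetP/codomP => [[x _ ->]|[x ->]]; exists x.
have [sa Ha [cla [ha ka]]] := ker false.
have [sb Hb [clb [hb kb]]] := ker true.
have Hc := all_In (all_In Hall Ha) Hb.
pose sz c := if c then sb else sa; pose cl c := if c then clb else cla.
pose hs c := if c then hb else ha.
have kc c : kernel (f c) (sz c) (cl c) (hs c) by case: c.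
suff /(_ u) : forall u, #|missed f u| <= 2 by rewrite leqNgt Hu.
have m0 : models f sz cl hs [::] (start sa sb) by split.
apply: (explore_ok kc small m0 Hc) => // it.
apply: (@reached_spawn _ f w [::] [::] [::]) => //.
move=> i _; apply/subsetP => x; by rewrite !inE.
Qed.

(** * The collapsing word *)

(* Found by a search over finitely many automata refined by the counterexamples of
   the exploration, then lengthened to make the exploration small. *)
Definition collapsing_word : seq bool :=
  let a := false in let b := true in
  [:: a; b; b; a; a; b; b; a; a; a; b; b; a; a; b; a; b; b; a; a;
      b; a; a; b; b; a; b; a; b; a; a; b; b; a; b; b; a; a; b; a;
      b; a; a; b; b; a; b; b; b; a; b; b; a].

Lemma collapsing_word_collapses : collapses collapsing_word.
Proof.
apply: (@collapses_by_exploration _ 400).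
  case; last by exists [::], (behead collapsing_word).
  by exists [:: false; true], (drop 3 collapsing_word).
by vm_compute.
Qed.

(** * Search for short words *)

(** The tables of the actions of the letters [false] and [true]. *)
Definition automaton := (seq nat * seq nat)%type.
Definition table (a : automaton) (c : bool) : seq nat := if c then a.2 else a.1.
Definition nstates (a : automaton) : nat := size a.1.

Fixpoint clear (i : nat) (s : bitseq) : bitseq :=
  match s, i with
  | [::], _ => [::]
  | _ :: s', 0 => false :: s'
  | b :: s', i'.+1 => b :: clear i' s'
  end.

(* A state is kept if it is the image of a state that is not lost. *)
Fixpoint lost_mask_rec (full : bitseq) (t : seq nat) (M : bitseq) : bitseq :=
  match t, M with
  | i :: t', b :: M' =>
    let s := lost_mask_rec full t' M' in if b then s else clear i s
  | _, _ => full
  end.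

Definition lost_mask (t : seq nat) (M : bitseq) : bitseq :=
  lost_mask_rec (nseq (size t) true) t M.

Definition crushed (M : bitseq) : bool := 2 < count id M.

(** Lost sets with more than two states are merged into the full mask, which is
    absorbing. *)
Definition mask_step (a : automaton) (c : bool) (M : bitseq) : bitseq :=
  let M' := lost_mask (table a c) M in
  if crushed M' then nseq (size M') true else M'.

Definition mask_start (a : automaton) : bitseq := nseq (nstates a) false.

Definition mask_run (a : automaton) (w : seq bool) : bitseq :=
  foldl (fun M c => mask_step a c M) (mask_start a) w.

Fixpoint team_step (g : seq automaton) (c : bool) (Ms : seq bitseq) : seq bitseq :=
  match g, Ms with
  | a :: g', M :: Ms' => mask_step a c M :: team_step g' c Ms'
  | _, _ => [::]
  end.

Definition team_start (g : seq automaton) : seq bitseq := map mask_start g.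
Definition team_run (g : seq automaton) Ms (w : seq bool) :=
  foldl (fun Ms c => team_step g c Ms) Ms w.

(** Maps whose keys are bit strings. *)
Inductive trie (A : Type) := Empty | Branch of option A & trie A & trie A.
Arguments Empty {A}.

Fixpoint get A (t : trie A) (k : seq bool) : option A :=
  match t with
  | Empty => None
  | Branch o l r =>
    match k with [::] => o | b :: k' => get (if b then r else l) k' end
  end.

Fixpoint single A (k : seq bool) (x : A) : trie A :=
  match k with
  | [::] => Branch (Some x) Empty Empty
  | true :: k' => Branch None Empty (single k' x)
  | false :: k' => Branch None (single k' x) Empty
  end.

Fixpoint put A (t : trie A) (k : seq bool) (x : A) : trie A :=
  match t with
  | Empty => single k x
  | Branch o l r =>
    match k with
    | [::] => Branch (Some x) l r
    | true :: k' => Branch o l (put r k' x)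
    | false :: k' => Branch o (put l k' x) r
    end
  end.

Fixpoint tmap A B (F : A -> B) (t : trie A) : trie B :=
  match t with
  | Empty => Empty
  | Branch o l r => Branch (if o is Some x then Some (F x) else None) (tmap F l) (tmap F r)
  end.

Fixpoint tall A (p : A -> bool) (t : trie A) : bool :=
  match t with
  | Empty => true
  | Branch o l r => (if o is Some x then p x else true) && (tall p l && tall p r)
  end.

Fixpoint succ_key (k : seq bool) : seq bool :=
  match k with
  | [::] => [:: true]
  | true :: k' => false :: succ_key k'
  | false :: k' => true :: k'
  end.

(** A node of the product of the lost-set automata of a team: its masks and the
    keys of its two successors. *)
Definition node := (seq bitseq * seq bool * seq bool)%type.

Section Graph.
Variable g : seq automaton.

(** Depth-first construction of the product. The keys are successive binary
    numerals, shorter than the masks themselves. Instead of proving this function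
    correct, [graph_ok] checks the graph that it returns; a node that is missing
    only weakens the verdicts. *)
Fixpoint grow (fuel : nat) (stack : seq (seq bool * seq bitseq)) (seen : trie (seq bool))
    (next : seq bool) (graph : trie node) : trie node :=
  match fuel, stack with
  | fuel'.+1, (k, Ms) :: stack' =>
    let Ma := team_step g false Ms in
    let Mb := team_step g true Ms in
    let keya := flatten Ma in
    let keyb := flatten Mb in
    let: (ka, seen1, next1, stack1) :=
      match get seen keya with
      | Some ka => (ka, seen, next, stack')
      | None => (next, put seen keya next, succ_key next, (next, Ma) :: stack')
      end in
    let: (kb, seen2, next2, stack2) :=
      match get seen1 keyb with
      | Some kb => (kb, seen1, next1, stack1)
      | None => (next1, put seen1 keyb next1, succ_key next1, (next1, Mb) :: stack1)
      end in
    grow fuel' stack2 seen2 next2 (put graph k (Ms, ka, kb))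
  | _, _ => graph
  end.

Definition team_graph : trie node :=
  (* larger than the number of nodes of any of the graphs below *)
  grow 3000 [:: ([::], team_start g)] (single (flatten (team_start g)) [::]) [:: true] Empty.

Definition points_to (G : trie node) (k : seq bool) (Ms : seq bitseq) : bool :=
  if get G k is Some (Ns, _, _) then Ns == Ms else true.

Definition graph_ok (G : trie node) : bool :=
  tall (fun x : node => let: (Ms, ka, kb) := x in
    points_to G ka (team_step g false Ms) && points_to G kb (team_step g true Ms)) G.

End Graph.

(** What a team says about the words of a given length that remain to be read:
    [Refuted] if none of them compresses the whole team, [Unknown] if the team
    gives no constraint, and otherwise the verdicts after each letter. *)
Inductive verdict := Refuted | Unknown | Ask of verdict & verdict.

Definition lookup (l : trie verdict) (k : seq bool) : verdict :=
  if get l k is Some v then v else Unknown.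

Definition ask (v w : verdict) : verdict :=
  match v, w with Refuted, Refuted => Refuted | _, _ => Ask v w end.

(** The verdicts of all nodes for [r] letters to go. A level refers to the
    previous one, so that the verdicts are shared, and [Refuted] marks the nodes
    that are too far from a compressed team; masks are then needed only at the
    leaves of the search. *)
Fixpoint level (G : trie node) (r : nat) : trie verdict :=
  match r with
  | 0 => tmap (fun x : node => if all crushed x.1.1 then Unknown else Refuted) G
  | r'.+1 =>
    let prev := level G r' in
    tmap (fun x : node => if all crushed x.1.1 then Unknown
      else ask (lookup prev x.1.2) (lookup prev x.2)) G
  end.

(* The verdict after the first letter, taken to be [false]. *)
Definition team_verdict (g : seq automaton) (r : nat) : verdict :=
  let G := team_graph g in
  if graph_ok g G then
    if get G [::] is Some (Ms, ka, _) then
      if Ms == team_start g then lookup (level G r) ka else Unknown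
    else Unknown
  else Unknown.

Fixpoint advance_all (c : bool) (l : seq verdict) : option (seq verdict) :=
  match l with
  | [::] => Some [::]
  | Ask x y :: l' =>
    match (if c then y else x) with
    | Refuted => None
    | Unknown => advance_all c l'
    | v => if advance_all c l' is Some s then Some (v :: s) else None
    end
  | _ :: l' => advance_all c l'
  end.

Section Search.
Variable rest : seq automaton.

(** The tree of all words with [r] more letters, cut when a team is refuted; [u]
    is the word read so far, backwards. At a leaf one of the automata of [rest]
    must survive the word. *)
Fixpoint search (r : nat) (l : seq verdict) (u : seq bool) : bool :=
  match r with
  | 0 => has (fun a => ~~ crushed (mask_run a (rev u))) rest
  | r'.+1 =>
    (if advance_all false l is Some l' then search r' l' (false :: u) else true) &&
    (if advance_all true l is Some l' then search r' l' (true :: u) else true)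
  end.
End Search.

(** * Correctness of the search *)

Lemma get_tmap A B (F : A -> B) t k : get (tmap F t) k = omap F (get t k).
Proof.
elim: t k => [|o l IHl r IHr] [|b k] //=.
by case: b.
Qed.

Lemma tallP A (p : A -> bool) t k x : tall p t -> get t k = Some x -> p x.
Proof.
elim: t k => [|o l IHl r IHr] [|b k] //= /and3P[po pl pr].
  by move=> E; rewrite E in po.
by case: b; [apply: IHr | apply: IHl].
Qed.

Lemma nth_clear i s q : nth false (clear i s) q = (q != i) && nth false s q.
Proof. by elim: s i q => [|b s IH] [|i] [|q] //=; rewrite ?andbF ?IH. Qed.

Lemma size_clear i s : size (clear i s) = size s.
Proof. by elim: s i => [|b s IH] [|i] //=; rewrite IH. Qed.

Lemma lost_mask_recE n t M :
  size (lost_mask_rec (nseq n true) t M) = n /\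
  forall q, nth false (lost_mask_rec (nseq n true) t M) q =
    (if q < n then all (fun p => ~~ (p.1 == q) || p.2) (zip t M) else false).
Proof.
have base : size (nseq n true) = n /\
    forall q, nth false (nseq n true) q = (if q < n then true else false).
  by split=> [|q]; rewrite ?size_nseq ?nth_nseq.
elim: t M => [|i t IH] [|b M] //=; have [IH1 IH2] := IH M.
case: b => /=; first by split=> // q; rewrite IH2 orbT.
split=> [|q]; first by rewrite size_clear.
by rewrite nth_clear IH2 orbF eq_sym; case: ifP => //; rewrite andbF.
Qed.

Section Verdict.
Variable g : seq automaton.

(** The meaning of the verdict [v] for [r] letters to read from the masks [Ms]. *)
Fixpoint valid (v : verdict) (Ms : seq bitseq) (r : nat) : Prop :=
  match v with
  | Unknown => True
  | Refuted => forall w, size w = r -> ~~ all crushed (team_run g Ms w)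
  | Ask v0 v1 => exists r', [/\ r = r'.+1, valid v0 (team_step g false Ms) r'
      & valid v1 (team_step g true Ms) r']
  end.

Lemma ask_valid v w Ms r : valid v (team_step g false Ms) r ->
  valid w (team_step g true Ms) r -> valid (ask v w) Ms r.+1.
Proof.
move=> Hv Hw; have : valid (Ask v w) Ms r.+1 by exists r.
case: v w Hv Hw => [||v0 v1] [||w0 w1] //= Hv Hw _ [//|c u] [su].
by case: c; [apply: Hw | apply: Hv].
Qed.

Lemma level_valid G r k Ms ka kb : graph_ok g G ->
  get G k = Some (Ms, ka, kb) -> valid (lookup (level G r) k) Ms r.
Proof.
move=> okG; elim: r k Ms ka kb => [|r IH] k Ms ka kb Hk; rewrite /lookup get_tmap Hk /=.
  by case: ifP => //= Hd [|//] _; rewrite /= Hd.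
case: ifP => //= _; have /andP[] := tallP okG Hk.
have IH' k' c : points_to G k' (team_step g c Ms) ->
    valid (lookup (level G r) k') (team_step g c Ms) r.
  rewrite /points_to; case E: (get G k') => [[[Ns ka'] kb']|].
    by move/eqP => EN; rewrite -EN; apply: IH E.
  have -> : lookup (level G r) k' = Unknown; last by [].
  by rewrite /lookup; case: (r) => [|r'] /=; rewrite get_tmap E.
by move=> /IH' Ha /IH' Hb; apply: ask_valid.
Qed.

Lemma team_verdict_valid r :
  valid (team_verdict g r) (team_step g false (team_start g)) r.
Proof.
rewrite /team_verdict; move: (team_graph g) => G /=; case: ifP => // okG.
case E: (get _ _) => [[[Ms ka] kb]|] //.
case: eqP => // EMs; subst Ms.
have /andP[] := tallP okG E; rewrite /points_to.
case Ea: (get _ ka) => [[[Ns ka'] kb']|].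
  by move=> /eqP EN _; rewrite -EN; apply: level_valid Ea.
move=> _ _; have -> : lookup (level G r) ka = Unknown; last by [].
by rewrite /lookup; case: (r) => [|r'] /=; rewrite get_tmap Ea.
Qed.

End Verdict.

Section Search.
Variables (teams : seq (seq automaton)) (rest : seq automaton).

Definition all_crushed (w : seq bool) : Prop :=
  (forall g, g \in teams -> all crushed (team_run g (team_start g) w)) /\
  (forall a, a \in rest -> crushed (mask_run a w)).

Definition certified (u : seq bool) (r : nat) (v : verdict) : Prop :=
  exists2 g, g \in teams & valid g v (team_run g (team_start g) u) r.

Fixpoint All (P : verdict -> Prop) (l : seq verdict) : Prop :=
  if l is v :: l' then P v /\ All P l' else True.

Lemma advance_all_ok c u r l : All (certified u r.+1) l ->
  match advance_all c l with
  | Some l' => All (certified (rcons u c) r) l'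
  | None => forall w, size w = r -> ~ all_crushed (rcons u c ++ w)
  end.
Proof.
elim: l => [//|v l IH] /= [Hv Hl]; have {IH Hl} := IH Hl.
case: v Hv => [||v0 v1] //= [g Hg [r' [[<-] H0 H1]]] IH.
have Hv : certified (rcons u c) r (if c then v1 else v0).
  by exists g; rewrite // /team_run foldl_rcons; case: (c).
case: (if c then v1 else v0) Hv => [||x y] Hv //.
  move=> w sw [Hall _]; case: Hv => g' Hg' /= /(_ w sw) /negP; apply.
  by rewrite /team_run -foldl_cat; apply: Hall.
by case: (advance_all c l) IH.
Qed.

Lemma search_ok r l u : All (certified (rev u) r) l -> search rest r l u ->
  forall w, size w = r -> ~ all_crushed (rev u ++ w).
Proof.
elim: r l u => [|r IH] l u Hl /=.
  move=> /hasP[a Ha Hd] w /size0nil-> [_ /(_ a Ha)].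
  by rewrite cats0; apply/negP.
move=> /andP[Hf Ht] [//|c w] [sw]; rewrite -cat_rcons.
suff Hc : if advance_all c l is Some l' then search rest r l' (c :: u) else true.
  have := advance_all_ok c Hl; case: (advance_all c l) Hc => [l'|] Hs H; last exact: H.
  by rewrite -rev_cons in H *; apply: IH H Hs w sw.
by case: c; [move: Ht | move: Hf]; case: advance_all.
Qed.

Theorem no_short_word r :
  search rest r [seq team_verdict g r | g <- teams] [:: false] ->
  forall w, size w = r -> ~ all_crushed (false :: w).
Proof.
move=> H w sw; apply: (search_ok (u := [:: false]) _ H sw).
have H1 gs : {subset gs <= teams} -> All (certified [:: false] r) [seq team_verdict g r | g <- gs].
  elim: gs => //= g s IH sub; split.
    by exists g; [apply: sub; rewrite mem_head | apply: team_verdict_valid].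
  by apply: IH => x xs; apply: sub; rewrite inE xs orbT.
exact: H1.
Qed.

End Search.

Section Masks.
Variable a : automaton.

Definition well_formed (a : automaton) : bool :=
  [&& 0 < nstates a, size a.2 == nstates a & all (fun i => i < nstates a) (a.1 ++ a.2)].

Hypothesis wf : well_formed a.
Let n := (nstates a).-1.

Definition next_state (c : bool) (q : 'I_n.+1) : 'I_n.+1 := inord (nth 0 (table a c) q).

Lemma nstates_pred : n.+1 = nstates a.
Proof. by case/and3P: wf => pos _ _; rewrite prednK. Qed.

Lemma size_table c : size (table a c) = n.+1.
Proof. by rewrite nstates_pred; case/and3P: wf => _ /eqP ? _; case: c. Qed.

Lemma next_stateE c (q : 'I_n.+1) : next_state c q = nth 0 (table a c) q :> nat.
Proof.
rewrite inordK //; apply: (@leq_trans (nstates a)); last by rewrite -nstates_pred.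
have /allP : all (fun i => i < nstates a) (table a c).
  by case/and3P: wf => _ _; rewrite all_cat => /andP[]; case: (c).
by apply; apply: mem_nth; rewrite size_table ltn_ord.
Qed.

Definition masks (M : bitseq) (X : {set 'I_n.+1}) : Prop :=
  size M = n.+1 /\ forall q : 'I_n.+1, nth false M q = (q \in X).

Lemma lost_mask_ok c M X : masks M X -> masks (lost_mask (table a c) M) (lost next_state c X).
Proof.
case=> sM HM; rewrite /lost_mask.
have [sL HL] := lost_mask_recE (size (table a c)) (table a c) M.
split; first by rewrite sL size_table.
move=> q; rewrite HL size_table ltn_ord inE.
apply/(all_nthP (0, false))/forallP.
- move=> H p; apply/implyP => /eqP E.
  have /H : p < size (zip (table a c) M) by rewrite size_zip size_table sM minnn.
  rewrite nth_zip /=; last by rewrite size_table sM.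
  by rewrite HM -next_stateE E eqxx.
- move=> H i; rewrite size_zip size_table sM minnn => Hi.
  rewrite nth_zip /=; last by rewrite size_table sM.
  have := H (Ordinal Hi); rewrite -(HM (Ordinal Hi)) /= implybE.
  by rewrite -(next_stateE c (Ordinal Hi)).
Qed.

Lemma card_masks M X : masks M X -> count id M = #|X|.
Proof.
case=> sM HM; rewrite -(mkseq_nth false M) sM.
rewrite /mkseq count_map -val_enum_ord count_map cardE size_filter -enumT.
by apply: eq_count => q /=; apply: HM.
Qed.

Lemma mask_run_ok w :
  if crushed (mask_run a w) then (2 < #|missed next_state w| : Prop)
  else masks (mask_run a w) (missed next_state w).
Proof.
suff : if crushed (mask_run a w) then 2 < #|missed next_state w| /\ mask_run a w = nseq n.+1 true
       else masks (mask_run a w) (missed next_state w).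
  by case: ifP => // _ [].
elim/last_ind: w => [|w c IH].
  rewrite /mask_run /mask_start /= /crushed -nstates_pred count_nseq mul0n.
  split; first by rewrite size_nseq.
  by move=> q; rewrite nth_nseq ltn_ord missed_nil inE.
rewrite /mask_run foldl_rcons -/(mask_run a w) missed_rcons /mask_step.
case: ifP IH => [_ [card_w Em]|_ Hm]; first rewrite Em.
  have full : lost_mask (table a c) (nseq n.+1 true) = nseq n.+1 true.
    have [sM HM] : masks (lost_mask (table a c) (nseq n.+1 true)) setT.
      have -> : setT = lost next_state c setT.
        by apply/setP => q; rewrite !inE; apply/esym/forallP => p; rewrite inE implybT.
      apply: lost_mask_ok; split; first by rewrite size_nseq.
      by move=> q; rewrite nth_nseq ltn_ord inE.
    apply: (@eq_from_nth _ false); first by rewrite sM size_nseq.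
    by move=> i; rewrite sM => Hi; rewrite nth_nseq Hi (HM (Ordinal Hi)) inE.
  have big : 2 < n.+1.
    by apply: leq_trans card_w _; rewrite -[X in _ <= X]card_ord max_card.
  have dfull : crushed (nseq n.+1 true) by rewrite /crushed count_nseq /= mul1n.
  rewrite full dfull size_nseq dfull; split=> //.
  apply: leq_trans card_w _; rewrite -missed_rcons -cats1.
  exact: leq_missed_factor next_state [::] w [:: c].
have Hl := lost_mask_ok c Hm.
case Ed': (crushed (lost_mask _ _)); last by rewrite Ed'.
have : 2 < n.+1.
  by apply: leq_trans Ed' _; rewrite (card_masks Hl) -[X in _ <= X]card_ord max_card.
case: Hl => sM _ big; rewrite sM.
rewrite /crushed count_nseq mul1n big; split=> //.
by rewrite -(card_masks (lost_mask_ok c Hm)).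
Qed.

Lemma doneE w : crushed (mask_run a w) = (2 < #|missed next_state w|).
Proof.
by have := mask_run_ok w; case: ifP => [_ ->|Ed /card_masks <-].
Qed.

End Masks.

Lemma collapses_done w w' a : well_formed a -> crushed (mask_run a w') ->
  collapses w -> crushed (mask_run a w).
Proof. by move=> wf; rewrite !(doneE wf) => H [_ Hw]; exact: Hw H. Qed.

Lemma team_run_done g w : all (fun a => crushed (mask_run a w)) g ->
  all crushed (team_run g (team_start g) w).
Proof.
suff -> : team_run g (team_start g) w = [seq mask_run a w | a <- g] by rewrite all_map.
elim/last_ind: w => [|w c IH]; first by [].
rewrite /team_run foldl_rcons -/(team_run _ _ _) IH.
have -> : [seq mask_run a (rcons w c) | a <- g] = [seq mask_step a c (mask_run a w) | a <- g].
  by apply: eq_map => a; rewrite /mask_run foldl_rcons.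
by elim: g {IH} => //= a g ->.
Qed.

(** A shorter collapsing word could be padded to exactly [r.+1] letters; being
    collapsing, it would compress every automaton of the teams, as these are
    compressed by [w0], and the search excludes this. *)
Theorem lower_bound teams rest r w0 :
  search rest r [seq team_verdict g r | g <- teams] [:: false] ->
  all (fun a => well_formed a && crushed (mask_run a w0)) (flatten teams ++ rest) ->
  forall w, head false w = false -> collapses w -> r.+1 < size w.
Proof.
move=> Hs Hwf w hw Hw; rewrite ltnNge; apply/negP => sw.
have [w1 Ew] : exists w1, w = false :: w1.
  by case: Hw => + _; case: w hw {sw} => [//|b w1] /= ->; exists w1.
pose v := w1 ++ nseq (r - size w1) false.
have sv : size v = r by rewrite size_cat size_nseq subnKC //; rewrite Ew in sw.
have Hv : collapses (false :: v).
  split=> // T f u Hu; rewrite -cat_cons -Ew.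
  apply: leq_trans (proj2 Hw T f u Hu) _.
  exact: leq_missed_factor f [::] w (nseq _ _).
have Hd a : a \in flatten teams ++ rest -> crushed (mask_run a (false :: v)).
  by move/(allP Hwf) => /andP[wa da]; apply: collapses_done wa da Hv.
apply: (no_short_word Hs sv); split=> [g Hg|a Ha]; last by apply: Hd; rewrite mem_cat Ha orbT.
apply: team_run_done; apply/allP => a Ha; apply: Hd.
by rewrite mem_cat; apply/orP; left; apply/flattenP; exists g.
Qed.

(** * The automata *)

(** These 3-compressible automata have few short 3-compressing words. *)
Definition small_automata : seq automaton := [::
  ([:: 1; 0; 1; 2], [:: 1; 2; 3; 1]);
  ([:: 1; 1; 2; 3], [:: 1; 2; 3; 0]);
  ([:: 1; 1; 3; 2], [:: 1; 2; 0; 3]);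
  ([:: 1; 1; 3; 2], [:: 1; 2; 3; 0]);
  ([:: 1; 2; 0; 1], [:: 3; 1; 2; 1]);
  ([:: 1; 2; 0; 3], [:: 1; 1; 3; 2]);
  ([:: 1; 2; 0; 3], [:: 2; 2; 3; 1]);
  ([:: 1; 2; 0; 3], [:: 3; 1; 3; 2]);
  ([:: 1; 2; 0; 3], [:: 3; 3; 1; 2]);
  ([:: 1; 2; 0; 3], [:: 3; 3; 2; 1]);
  ([:: 1; 2; 1; 0], [:: 1; 3; 2; 1]);
  ([:: 1; 2; 3; 0], [:: 1; 1; 2; 3]);
  ([:: 1; 2; 3; 0], [:: 1; 1; 3; 2]);
  ([:: 1; 2; 3; 0], [:: 2; 2; 3; 1]);
  ([:: 1; 2; 3; 0], [:: 3; 3; 2; 1]);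
  ([:: 2; 2; 3; 0], [:: 2; 3; 3; 1]);
  ([:: 2; 2; 3; 1], [:: 1; 2; 0; 3]);
  ([:: 2; 2; 3; 1], [:: 1; 2; 3; 0]);
  ([:: 2; 3; 3; 1], [:: 2; 2; 3; 0]);
  ([:: 3; 1; 2; 1], [:: 1; 2; 0; 1]);
  ([:: 3; 1; 3; 2], [:: 1; 2; 0; 3]);
  ([:: 3; 3; 1; 2], [:: 1; 2; 0; 3]);
  ([:: 3; 3; 2; 0], [:: 2; 1; 1; 3]);
  ([:: 3; 3; 2; 1], [:: 1; 2; 0; 3]);
  ([:: 3; 3; 2; 1], [:: 1; 2; 3; 0]);
  ([:: 0; 4; 1; 3; 2], [:: 4; 3; 2; 0; 3]);
  ([:: 1; 2; 0; 3; 4], [:: 3; 1; 3; 4; 2]);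
  ([:: 1; 2; 0; 4; 3], [:: 3; 1; 3; 2; 4]);
  ([:: 1; 2; 3; 0; 4], [:: 4; 4; 2; 3; 1]);
  ([:: 1; 2; 3; 4; 0], [:: 2; 3; 2; 3; 4]);
  ([:: 2; 3; 2; 3; 4], [:: 1; 2; 3; 4; 0]);
  ([:: 2; 3; 3; 4; 0], [:: 1; 2; 0; 3; 4]);
  ([:: 3; 1; 3; 4; 2], [:: 1; 2; 0; 3; 4]);
  ([:: 3; 3; 2; 4; 1], [:: 1; 2; 0; 3; 4]);
  ([:: 1; 2; 3; 0; 5; 4], [:: 4; 4; 3; 2; 1; 5]);
  ([:: 2; 2; 3; 5; 0; 4], [:: 4; 3; 1; 5; 3; 2]);
  ([:: 2; 2; 4; 3; 1; 5], [:: 1; 3; 4; 0; 5; 2]);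
  ([:: 2; 5; 2; 5; 4; 3], [:: 1; 2; 3; 4; 5; 0]);
  ([:: 2; 5; 4; 3; 0; 2], [:: 4; 4; 3; 2; 5; 1]);
  ([:: 4; 4; 3; 2; 5; 1], [:: 2; 5; 4; 3; 0; 2])].

(** Numbers of automata in [small_automata], chosen greedily to cut the search
    early; the first teams cut most. *)
Definition teams : seq (seq nat) := [::
  [:: 8; 9; 6; 23; 20];
  [:: 23; 21; 6; 16; 37];
  [:: 1; 11; 23; 12];
  [:: 9; 1; 11; 3];
  [:: 9; 16; 21; 39];
  [:: 16; 23; 21; 7];
  [:: 23; 38; 8; 29];
  [:: 8; 1; 39; 20];
  [:: 1; 12; 21; 24];
  [:: 8; 16; 9; 6];
  [:: 8; 20; 11; 14];
  [:: 23; 11; 8; 6];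
  [:: 9; 1; 21; 16];
  [:: 9; 38; 39; 11];
  [:: 9; 3; 7; 11];
  [:: 9; 1; 20; 3];
  [:: 8; 30; 6; 19];
  [:: 1; 12; 11; 4];
  [:: 21; 9; 16; 20];
  [:: 23; 9; 12; 11];
  [:: 23; 1; 6; 29];
  [:: 8; 16; 6; 21];
  [:: 11; 1; 3; 8];
  [:: 9; 24; 21; 1];
  [:: 1; 16; 21; 35];
  [:: 2; 18; 15; 0];
  [:: 25; 33; 18];
  [:: 5; 15; 24];
  [:: 5; 33; 3];
  [:: 25; 2; 5];
  [:: 25; 15; 0; 26];
  [:: 17; 0; 15; 10];
  [:: 2; 10; 32; 22];
  [:: 5; 28; 31];
  [:: 5; 18; 32; 22];
  [:: 13; 26; 18; 0];
  [:: 14; 2; 5];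
  [:: 2; 34; 7];
  [:: 0; 36; 27];
  [:: 8; 2; 15; 21];
  [:: 5; 26; 1]].

(** Automata for the words of length 33 that compress all teams. *)
Definition last_automata : seq automaton := [::
  ([:: 3; 3; 1; 4; 2], [:: 1; 2; 0; 4; 3]);
  ([:: 1; 2; 0; 3; 4], [:: 2; 3; 3; 4; 0]);
  ([:: 1; 2; 0; 4; 3], [:: 3; 3; 2; 4; 1]);
  ([:: 2; 2; 3; 4; 1], [:: 1; 2; 0; 3; 4]);
  ([:: 1; 2; 3; 4; 0], [:: 1; 1; 3; 4; 2]);
  ([:: 3; 1; 3; 4; 6; 5; 2], [:: 1; 2; 0; 4; 6; 3; 5]);
  ([:: 1; 2; 0; 5; 3; 4], [:: 3; 3; 2; 5; 4; 1]);
  ([:: 3; 3; 2; 4; 5; 1], [:: 1; 2; 0; 4; 3; 5]);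
  ([:: 1; 1; 3; 4; 2], [:: 1; 2; 0; 3; 4]);
  ([:: 1; 2; 3; 0], [:: 2; 2; 1; 3]);
  ([:: 1; 2; 0; 4; 3; 5], [:: 3; 3; 1; 5; 4; 2]);
  ([:: 4; 4; 3; 2; 5; 1], [:: 1; 2; 0; 3; 4; 5]);
  ([:: 3; 3; 2; 6; 5; 1; 7; 4], [:: 1; 2; 0; 4; 5; 3; 7; 6]);
  ([:: 3; 3; 2; 4; 1], [:: 1; 2; 0; 4; 3]);
  ([:: 3; 3; 1; 4; 2; 5], [:: 1; 2; 0; 4; 5; 3]);
  ([:: 3; 3; 2; 4; 5; 1], [:: 1; 2; 0; 4; 5; 3]);
  ([:: 1; 2; 0; 4; 5; 3], [:: 3; 3; 2; 4; 5; 1]);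
  ([:: 3; 4; 2; 1; 3], [:: 4; 1; 3; 0; 2]);
  ([:: 3; 3; 1; 5; 2; 4], [:: 1; 2; 0; 4; 5; 3])].

Definition team_automata : seq (seq automaton) :=
  [seq [seq nth ([::], [::]) small_automata i | i <- t] | t <- teams].

Lemma search_team_automata :
  search last_automata 32 [seq team_verdict g 32 | g <- team_automata] [:: false].
Proof. by vm_cast_no_check (erefl true). Qed.

Lemma size_collapses w : collapses w -> 33 < size w.
Proof.
have compressible_automata : all (fun a => well_formed a && crushed (mask_run a collapsing_word))
    (flatten team_automata ++ last_automata) by vm_compute.
have bound0 v : head false v = false -> collapses v -> 33 < size v.
  exact: lower_bound search_team_automata compressible_automata v.
case: w => [|[] w] Hw; [exact: bound0 | | exact: bound0].
by have := bound0 (map negb (true :: w)) erefl (collapses_negb Hw); rewrite size_map.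
Qed.

(** * The shortest length *)

Lemma least_witness (P : nat -> Prop) n : P n ->
  exists2 m, P m & forall k, P k -> m <= k.
Proof.
elim/ltn_ind: n => n IH Pn.
have [[k [ltkn Pk]]|none] := classic (exists k, k < n /\ P k); first exact: IH Pk.
exists n => // k Pk; rewrite leqNgt; apply/negP => ltkn.
by apply: none; exists k.
Qed.

Theorem mainTheorem4 :
  exists c : nat, is_shortest_collapsing_length 3 2 c /\ 34 <= c <= 53.
Proof.
pose P n := exists2 w, collapses w & size w = n.
have P53 : P 53 by exists collapsing_word => //; apply: collapsing_word_collapses.
have [c Pc minc] := least_witness P53.
exists c; split; last first.
  by rewrite minc // andbT; have [w Hw <-] := Pc; apply: size_collapses.
move=> Sigma /two_letters[enc [dec [encK decK]]]; split.
  have [w Hw <-] := Pc; exists (map dec w); last by rewrite size_map.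
  by apply/(collapsing_collapses encK decK); rewrite (mapK decK).
move=> w /(collapsing_collapses encK decK) Hw.
by apply: minc; exists (map enc w); rewrite ?size_map.
Qed.
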